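(* Let $\pi^:$ be a decorated permutation on a finite totally ordered set $E=\{e_1<e_2<\dots<e_n\}$. Then there exists a connected planar graph $G$ with (ordered) edge set $E$ such that $\pi^:=\pi^:_{M(G)}$.
   Context: Graphs are finite; loops and multiple edges are allowed, and the edge set is totally ordered. $M(G)$ denotes the cycle matroid of $G$: the matroid on the edge set of $G$ whose bases are the maximal forests of $G$; it is an ordered matroid (a matroid whose ground set is totally ordered) via the order on the edges. A decorated permutation on $E$ is a pair $\pi^:=(\pi,col)$ with $\pi:E\to E$ a permutation and $col:\{\text{fixed points of }\pi\}\to\{-1,1\}$ a function. For a fixed point $e_i$ write $\pi^:(e_i)=\overline{e_i}$ if $col(e_i)=-1$ and $\pi^:(e_i)=\underline{e_i}$ if $col(e_i)=1$. Let $\leq_i$ be the total order $e_i<_i e_{i+1}<_i\dots<_i e_n<_i e_1<_i\dots<_i e_{i-1}$ on $E$, and let $[e_i,e_j]=\{e_k\in E: e_i\leq_i e_k\leq_i e_j\}$ be the cyclic interval (indices modulo $n$). For an ordered matroid $M$ on $E$ with closure operator $\mathrm{cl}$, the decorated permutation $\pi^:_M$ associated to $M$ is $$\pi^:_M(e_i)=\begin{cases}\overline{e_i}, & e_i\text{ a coloop of }M,\\ \underline{e_i}, & e_i \text{ a loop of }M,\\ \min_{\leq_i}\{e_j\in E\setminus\{e_i\}: e_i\in \mathrm{cl}([e_{i+1},e_j])\}, & \text{otherwise.}\end{cases}$$ *)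

(* Defs.v *)
From HB Require Import structures.
From mathcomp Require Import boolp classical_sets interval reals topology.
From mathcomp Require Import normedtype.
From mathcomp Require Import all_boot all_order perm ssralg ssrnum.
Import numFieldNormedType.Exports.

Set Implicit Arguments.
Unset Strict Implicit.
Unset Printing Implicit Defensive.

Import Order.TTheory GRing.Theory Num.Theory.

Record matroid (E : finType) := Matroid {
  bases : {set {set E}};
  bases_neq0 : bases != set0;
  bases_exchange : forall B1 B2 e, B1 \in bases -> B2 \in bases ->
    e \in B1 :\: B2 ->
    exists2 f, f \in B2 :\: B1 & f |: (B1 :\ e) \in bases }.

Section MatroidNotions.
Variables (E : finType) (M : matroid E).

Definition mrank (A : {set E}) : nat := \max_(B in bases M) #|A :&: B|.

Definition mclosure (A : {set E}) : {set E} :=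
  [set x | mrank (x |: A) == mrank A].

Definition mloop (e : E) : bool := [forall B in bases M, e \notin B].

Definition mcoloop (e : E) : bool := [forall B in bases M, e \in B].

End MatroidNotions.

(* The order of the two ends of an edge is immaterial; a loop is an edge whose
   two ends are equal. *)
Record graph (E : finType) := Graph {
  vertex : finType;
  ends : E -> vertex * vertex }.

Section GraphNotions.
Variables (E : finType) (G : graph E).

Definition joins (e : E) (u v : vertex G) : bool :=
  (ends G e == (u, v)) || (ends G e == (v, u)).

Definition adj (F : {set E}) : rel (vertex G) :=
  fun u v => [exists e in F, joins e u v].

Definition connected_graph : bool :=
  (0 < #|vertex G|) && [forall u, forall v, connect (adj [set: E]) u v].

(* [:: (v_1, a_1); ...; (v_k, a_k)] stands for the cycle
   v_1 -a_1- v_2 -a_2- ... v_k -a_k- v_1; a loop is a cycle with k = 1 and two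
   parallel edges form a cycle with k = 2. *)
Definition graph_cycle (c : seq (vertex G * E)) : bool :=
  [&& c != [::], uniq (map fst c), uniq (map snd c)
    & cycle (fun p q => joins p.2 p.1 q.1) c].

Definition forest (F : {set E}) : Prop :=
  ~ exists2 c, graph_cycle c & {subset map snd c <= F}.

Definition maximal_forests : {set {set E}} :=
  [set F | maxset (fun F' => `[< forest F' >]) F].

(* G can be drawn in the plane: pos places the vertices, and gamma e,
   restricted to [0, 1], is the curve representing the edge e. *)
Definition planar (R : realType) : Prop :=
  exists (pos : vertex G -> R * R) (gamma : E -> R -> R * R),
  [/\ injective pos,
      forall e, [/\ {within `[0%R, 1%R], continuous (gamma e)}%classic,
                    gamma e 0%R = pos (ends G e).1
                  & gamma e 1%R = pos (ends G e).2],
      forall e (t : R) v, (0 < t < 1)%R -> gamma e t <> pos v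
    & forall e f (s t : R), (0 < s < 1)%R -> (0 < t < 1)%R ->
        gamma e s = gamma f t -> e = f /\ s = t].

End GraphNotions.

Section CycleMatroid.
Variables (E : finType) (G : graph E).
Implicit Types (F B : {set E}) (e f g : E) (u v w : vertex G).

Lemma joinsC e u v : joins e u v = joins e v u.
Proof. by rewrite /joins orbC. Qed.

Lemma joins_ends e : joins e (ends G e).1 (ends G e).2.
Proof. by rewrite /joins -surjective_pairing eqxx. Qed.

Lemma adj_sym F : symmetric (@adj E G F).
Proof.
by move=> u v; apply/exists_inP/exists_inP => -[e eF]; rewrite joinsC => J;
  exists e.
Qed.

Lemma adj_csym F : connect_sym (@adj E G F).
Proof. exact/sym_connect_sym/adj_sym. Qed.

Lemma connect_adjS F F' u v : F \subset F' ->
  connect (@adj E G F) u v -> connect (@adj E G F') u v.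
Proof.
move=> sFF'; apply: connect_sub => x y /exists_inP[e eF J].
by apply/connect1/exists_inP; exists e => //; apply: (subsetP sFF').
Qed.

Let next_dart (p q : vertex G * E) := joins p.2 p.1 q.1.

Lemma path_edges F u (p : seq (vertex G)) : path (@adj E G F) u p ->
  uniq (u :: p) ->
  exists c : seq (vertex G * E), [/\ map fst c = belast u p,
    {subset map snd c <= F}, uniq (map snd c),
    forall a, a \in map snd c ->
      exists x y, [/\ x \in u :: p, y \in u :: p & joins a x y]
    & forall w b a, joins b (last u p) w ->
        let c' := rcons c (last u p, b) in
        path next_dart (head (u, b) c') (rcons (behead c') (w, a))].
Proof.
elim: p u => [|v p IH] u /=.
  by move=> _ _; exists [::]; split => // w b a J /=; rewrite /next_dart J.
move=> /andP[/exists_inP[e eF Je] pvp] /andP[unvp uvp].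
have [c [c1 cF c2 cE cP]] := IH v pvp uvp.
exists ((u, e) :: c); split => /=.
- by rewrite c1.
- by move=> a; rewrite inE => /predU1P[->|/cF].
- rewrite c2 andbT; apply/negP => /cE[x [y [xp yp]]].
  move: Je; rewrite /joins => /orP[]/eqP-> /orP[]/eqP[? ?]; subst;
    by rewrite ?xp ?yp in unvp.
- move=> a; rewrite inE => /predU1P[->|/cE[x [y [xp yp J]]]].
    by exists u, v; rewrite !inE !eqxx orbT.
  by exists x, y; split => //; rewrite inE ?xp ?yp orbT.
- move=> w b a J; have /= := cP w b a J.
  case: c c1 {cF c2 cE cP} => [|q c] /=.
    case: p {IH pvp uvp unvp J} => [|//] _ /=.
    by rewrite /next_dart /= => /andP[-> _]; rewrite Je.
  case: p {IH pvp uvp unvp J} => [//|z p] /= [q1 _] ->.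
  by rewrite /next_dart /= q1 Je.
Qed.

Lemma connect_cycle F e : e \notin F ->
  connect (@adj E G F) (ends G e).1 (ends G e).2 ->
  exists2 c, @graph_cycle E G c & {subset map snd c <= e |: F}.
Proof.
set u := _.1; set v := _.2 => eF /connectP[p0 p0P vE].
case/shortenP: p0P vE => p pP up _ vE.
have [c [c1 cF c2 _ cP]] := path_edges pP up.
have Je : joins e (last u p) u by rewrite -vE joinsC joins_ends.
exists (rcons c (last u p, e)).
  apply/and4P; split.
  - by case: (c).
  - by rewrite map_rcons /= c1 -lastI.
  - by rewrite map_rcons rcons_uniq c2 andbT; apply: contra eF => /cF.
  - case: c c1 {c2 cF} cP => [|q c] c1 /(_ u e) cP.
      by case: p {pP up vE} c1 Je cP => [|//] _ Je /(_ e Je).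
    have := cP q.2 Je; case: p {pP up cP vE Je} c1 => [//|z p] /= [<- _].
    by rewrite -surjective_pairing.
by move=> a; rewrite map_rcons mem_rcons !inE => /predU1P[->|/cF->];
  rewrite ?eqxx ?orbT.
Qed.

Lemma cycle_connect F e c : @graph_cycle E G c ->
  {subset map snd c <= e |: F} -> e \in map snd c ->
  connect (@adj E G (F :\ e)) (ends G e).1 (ends G e).2.
Proof.
move=> /and4P[_ _ c2 cc] cF /mapP[[u e'] qc /= ?]; subst e'.
have [i s sE] := rot_to qc.
have s2 : uniq (map snd ((u, e) :: s)) by rewrite -sE map_rot rot_uniq.
have sF : {subset map snd s <= F :\ e}.
  move=> a aS; have : a \in e |: F.
    apply: cF; have : a \in map snd (rot i c) by rewrite sE inE aS orbT.
    by rewrite map_rot mem_rot.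
  rewrite !inE; have : a != e.
    by apply: contraTneq aS => ->; have /= /andP[] := s2.
  by move=> ane; rewrite (negPf ane).
have : cycle next_dart ((u, e) :: s) by rewrite -sE rot_cycle.
move=> {s2 sE qc i cF c2 cc}.
have H : forall (q : vertex G * E) t, {subset map snd t <= F :\ e} ->
    path next_dart q (rcons t (u, e)) ->
    exists2 w, joins q.2 q.1 w & connect (@adj E G (F :\ e)) w u.
  move=> q t; elim: t q => [|[w a] t IH] q tF /=.
    by rewrite andbT => J; exists u.
  case/andP=> J /IH[b bt|w' J' w'u]; first by apply: tF; rewrite inE bt orbT.
  exists w => //; apply: connect_trans w'u.
  by apply/connect1/exists_inP; exists a => //; apply: tF; rewrite mem_head.
case/H => //= w; rewrite /joins => /orP[]/eqP-> //=.
by rewrite adj_csym.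
Qed.

Lemma forestU1 F e : forest G F -> e \notin F ->
  ~ connect (@adj E G F) (ends G e).1 (ends G e).2 -> forest G (e |: F).
Proof.
move=> fF eF ncon [c cc cF].
have [ec|ec] := boolP (e \in map snd c).
  apply: ncon; have := cycle_connect cc cF ec; apply: connect_adjS.
  exact: subD1set.
apply: fF; exists c => // a ac; have := cF a ac.
by rewrite !inE => /predU1P[aE|//]; rewrite -aE ac in ec.
Qed.

Lemma forestS F F' : F \subset F' -> forest G F' -> forest G F.
Proof. by move=> /subsetP s fF' [c cc cF]; apply: fF'; exists c => // a /cF/s. Qed.

Lemma forestD1 F e : forest G F -> e \in F ->
  ~ connect (@adj E G (F :\ e)) (ends G e).1 (ends G e).2.
Proof.
move=> fF eF con; have [|c cc cF] := connect_cycle _ con.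
  by rewrite !inE eqxx.
by apply: fF; exists c => // a /cF; rewrite setD1K.
Qed.

Lemma maximal_forestsP F : reflect
  (forest G F /\ forall e, connect (@adj E G F) (ends G e).1 (ends G e).2)
  (F \in maximal_forests G).
Proof.
rewrite /maximal_forests inE. apply: (iffP maxsetP) => -[].
  move/asboolP => fF mF; split => // e.
  have [eF|eF] := boolP (e \in F).
    by apply/connect1/exists_inP; exists e => //; apply: joins_ends.
  apply/negPn/negP => /negP ncon.
  have H : e |: F = F.
    by apply: mF; [exact/asboolP/forestU1 | exact: subsetUr].
  by move: eF; rewrite -H setU11.
move=> fF cF; split; first exact/asboolP.
move=> F' /asboolP fF' sFF'; apply/eqP; rewrite eqEsubset sFF' andbT.
apply/subsetP => e eF'; apply/negPn/negP => eF.
apply: (forestD1 fF' eF'); apply: connect_adjS (cF e).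
by apply/subsetD1P.
Qed.

Lemma maximal_forests_neq0 : maximal_forests G != set0.
Proof.
have f0 : forest G (set0 : {set E}).
  by move=> [[//|q c] _ cF]; have := cF q.2 (mem_head _ _); rewrite inE.
have [|F mF _] := @maxset_exists E (fun F => `[< forest G F >]) set0.
  exact/asboolP.
by apply/set0Pn; exists F; rewrite /maximal_forests inE.
Qed.

Lemma connectU1 F e u v : connect (@adj E G (e |: F)) u v ->
  [\/ connect (@adj E G F) u v,
      connect (@adj E G F) u (ends G e).1 /\
        connect (@adj E G F) (ends G e).2 v
    | connect (@adj E G F) u (ends G e).2 /\
        connect (@adj E G F) (ends G e).1 v].
Proof.
case/connectP => p; elim: p u => [|w p IH] u /=; first by move=> _ ->; apply: Or31.
case/andP=> /exists_inP[a /setU1P[->{a}|aF] J] /IH{}IH /IH{IH} H.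
  move: J; rewrite /joins.
  by case/orP=> /eqP eE; move: H; rewrite eE /= => -[H|[_ H]|[_ H]];
    do ?[by apply: Or31 | by apply: Or32 | by apply: Or33].
have uw : connect (@adj E G F) u w by apply/connect1/exists_inP; exists a.
case: H => [wv|[w1 w2]|[w1 w2]].
- by apply: Or31; apply: connect_trans wv.
- by apply: Or32; split => //; apply: connect_trans w1.
- by apply: Or33; split => //; apply: connect_trans w1.
Qed.

Lemma connect_cross F (a : pred (vertex G)) u v : connect (@adj E G F) u v ->
  a u -> ~~ a v ->
  exists f x y, [/\ f \in F, joins f x y, a x & ~~ a y].
Proof.
case/connectP => p; elim: p u => [|w p IH] u /=; first by move=> _ -> ->.
case/andP=> /exists_inP[f fF J] pP vE au nav.
have [aw|naw] := boolP (a w); first exact: IH pP vE aw nav.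
by exists f, u, w.
Qed.

Lemma maximal_forests_exchange B1 B2 e :
  B1 \in maximal_forests G -> B2 \in maximal_forests G -> e \in B1 :\: B2 ->
  exists2 f, f \in B2 :\: B1 & f |: (B1 :\ e) \in maximal_forests G.
Proof.
move=> /maximal_forestsP[f1 c1] /maximal_forestsP[_ c2] /setDP[e1 ne2].
set F := B1 :\ e; set u := (ends G e).1; set v := (ends G e).2.
have nuv : ~ connect (@adj E G F) u v by exact: forestD1.
have [f [x [y [f2 J ux /negP nuy]]]] :=
  connect_cross (c2 e) (connect0 _ u) (introN idP nuv).
have con g : g \in F -> connect (@adj E G F) (ends G g).1 (ends G g).2.
  by move=> gF; apply/connect1/exists_inP; exists g => //; apply: joins_ends.
have conJ K g a b : joins g a b ->
    connect (@adj E G K) (ends G g).1 (ends G g).2 = connect (@adj E G K) a b.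
  by rewrite /joins => /orP[]/eqP-> //=; rewrite adj_csym.
have nxy : ~ connect (@adj E G F) x y.
  by move=> xy; apply: nuy; apply: connect_trans xy.
have nfF : f \notin F by apply/negP => /con; rewrite (conJ _ _ _ _ J).
have fe : f != e by apply: contraNneq ne2 => <-.
have nf1 : f \notin B1 by move: nfF; rewrite !inE fe.
exists f; first by rewrite inE nf1.
apply/maximal_forestsP; split.
  apply: forestU1 => //; first exact: forestS (subD1set _ _) f1.
  by rewrite (conJ _ _ _ _ J).
have FS : F \subset f |: F by exact: subsetUr.
have xyF : connect (@adj E G (f |: F)) x y.
  by apply/connect1/exists_inP; exists f; rewrite ?setU11.
have uvF : connect (@adj E G (f |: F)) u v.
  have : connect (@adj E G (e |: F)) x y.
    by rewrite setD1K // -(conJ _ _ _ _ J).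
  case/connectU1 => [/nxy//|[_ vy]|[xv uy]].
    apply: connect_trans (connect_adjS FS ux) _.
    apply: connect_trans xyF _; rewrite adj_csym; exact: connect_adjS vy.
  by case: nuy.
move=> g; have := c1 g; rewrite -(setD1K e1) -/F.
case/connectU1 => [|[g1 g2]|[g1 g2]]; first exact: connect_adjS.
  apply: connect_trans (connect_adjS FS g1) _.
  exact: connect_trans uvF (connect_adjS FS g2).
apply: connect_trans (connect_adjS FS g1) _; rewrite adj_csym in uvF.
exact: connect_trans uvF (connect_adjS FS g2).
Qed.

Definition cycle_matroid : matroid E :=
  Matroid maximal_forests_neq0 maximal_forests_exchange.

End CycleMatroid.

Inductive color := Minus1 | Plus1.

Record decorated_perm (E : finType) := DecoratedPerm {
  dperm : {perm E};
  dcol : {e : E | dperm e == e} -> color }.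

(* The possible values of a decorated permutation: Over e and Under e are the
   decorated (overlined, underlined) fixed points, Plain e is undecorated. *)
Inductive decorated (E : Type) := Over of E | Under of E | Plain of E.

Definition dperm_value (E : finType) (pi : decorated_perm E) (e : E) :
    decorated E :=
  if (insub e : option {e : E | dperm pi e == e}) is Some x then
    if dcol x is Minus1 then Over e else Under e
  else Plain (dperm pi e).

Section OrderedMatroid.
Variables (d : Order.disp_t) (E : finOrderType d).

(* The order a < ... < max E < min E < ... on E, cyclically shifted to start
   at a. *)
Definition cyc_le (a x y : E) : bool :=
  if (x < a)%O == (y < a)%O then (x <= y)%O else (y < a)%O.

(* e_(i+1) for e = e_i, with indices modulo #|E|. *)
Definition cyc_succ (e : E) : E := Order.enum_val (ordS (Order.enum_rank e)).

Definition cyc_interval (a b : E) : {set E} :=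
  [set x | cyc_le a a x && cyc_le a x b].

Definition cyc_min (a : E) (S : {set E}) : option E :=
  [pick x in S | [forall y in S, cyc_le a x y]].

(* The default e of odflt is never used: if e is not a coloop, then it is in
   the closure of E \ {e}, which is [e_(i+1), e_(i-1)]. *)
Definition matroid_dperm_value (M : matroid E) (e : E) : decorated E :=
  if mcoloop M e then Over e
  else if mloop M e then Under e
  else Plain (odflt e (cyc_min e
         [set x in ~: [set e] | e \in mclosure M (cyc_interval (cyc_succ e) x)])).

End OrderedMatroid.

(* Main.v *)
Require Import Defs.
From mathcomp Require Import boolp classical_sets interval reals topology.
From mathcomp Require Import normedtype.
From mathcomp Require Import all_boot all_order perm ssralg ssrnum.
From mathcomp Require Import zify lra.

Set Implicit Arguments.
Unset Strict Implicit.
Unset Printing Implicit Defensive.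

Import Order.TTheory GRing.Theory Num.Theory.
Import numFieldNormedType.Exports.

(** The cycle matroid of a graph is represented over F_2 by its cuts, the
    coboundaries of vertex potentials: an edge [e] is in the closure of [F] iff
    every cut that misses [F] misses [e] ([mclosure_connect],
    [connect_potential]).  Two facts reduce the theorem to a splitting of cycles.

    First, the matroid of a permutation may be taken to be the direct sum of
    matroids for its cycles, however these are interleaved in the order: in a
    direct sum, the closure of [[e+1, x]] only sees the part of this interval
    in the summand of [e].  Loops and coloops take care of the fixed points.

    Second, let [f] be a cycle on [c] with at least two elements, [i, j] two
    consecutive elements of [c], and let [g] be [f] with the images of [i] and
    [j] exchanged.  Then [g] splits [c] into a cycle [c1] through [i] and a
    cycle [c2] through [j].  Take matroids for these two cycles, given by
    vectors [v_x]; if [i] (resp. [j]) is alone in its cycle, make it a coloop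
    (resp. a loop).  Replace [v_j] by [v_j + v_i] in the direct sum.  Only
    intervals that separate [i] from [j] are affected, and
    - [v_i] is in the span of [v_j + v_i] and a set [A] as soon as [v_i] or
      [v_j] is in the span of [A], so that [i] is sent to the first of the two
      targets [g i] and [g j];
    - [v_j + v_i] is in the span of [A] only when both [v_i] and [v_j] are, so
      that [j] is sent to the last of the two.
    Hence the result represents [f] as soon as [f i] comes before [f j] in the
    cyclic order that starts at [j] ([slide_realizes]).  Such a pair always
    exists: take for [i] an element whose cyclic distance to [f i] is minimal
    ([cycle_network]).

    On graphs, the replacement slides one end of the edge [j] along the edge
    [i]: the two graphs are merged into a ring made of [j], of the rest of the
    second graph, and of the first graph seen as a two-terminal network
    between the ends of [i].  Starting from single edges one only gets
    series-parallel networks.  To recognize this by induction one has to view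
    a graph as a network between the ends of any of its edges, which is why
    the induction produces one network for each choice of the root edge.

    Finally, the networks of all cycles are put in series, and the loops are
    attached at a vertex.  The drawing is explicit: networks are drawn in a
    lens, and two networks are combined in series or in parallel by mapping
    the lens into itself by simple polynomial maps ([drawn_curve],
    [drawn_chain]). *)

(** * Distances in the cyclic order *)

Section CyclicOrder.
Variables (d : Order.disp_t) (E : finOrderType d).
Implicit Types (e i j x y : E) (k : nat).

Definition rank e : nat := Order.enum_rank e.

Lemma rank_lt e : rank e < #|E|. Proof. exact: ltn_ord. Qed.

Lemma rank_inj : injective rank.
Proof. by move=> x y /val_inj/Order.enum_rank_inj. Qed.

Lemma rank_le x y : (x <= y)%O = (rank x <= rank y).
Proof. by rewrite -(Order.le_enum_rank (@le_total _ E)) leEord. Qed.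

Lemma rank_ltE x y : (x < y)%O = (rank x < rank y).
Proof. by rewrite ltNge rank_le -ltnNge. Qed.

Definition cdist e y : nat :=
  if rank e <= rank y then rank y - rank e else rank y + #|E| - rank e.

Lemma cdist_eq0 e y : (cdist e y == 0) = (y == e).
Proof.
rewrite -(inj_eq rank_inj) /cdist; have := rank_lt e; have := rank_lt y.
by case: ifP; lia.
Qed.

Lemma cdist_inj e : injective (cdist e).
Proof.
move=> x y; rewrite /cdist => H; apply: rank_inj; move: H.
by have := rank_lt x; have := rank_lt y; have := rank_lt e; do 2 case: ifP; lia.
Qed.

Lemma cdist_lt e y : cdist e y < #|E|.
Proof.
by rewrite /cdist; have := rank_lt e; have := rank_lt y; case: ifP; lia.
Qed.

Lemma cyc_leE e x y : cyc_le e x y = (cdist e x <= cdist e y).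
Proof.
rewrite /cyc_le /cdist !rank_ltE rank_le.
have := rank_lt x; have := rank_lt y; have := rank_lt e.
case: (ltnP (rank x) (rank e)); case: (ltnP (rank y) (rank e)) => /=; lia.
Qed.

Lemma cdist_add i j y : cdist i j <= cdist i y ->
  cdist i y = cdist i j + cdist j y.
Proof.
rewrite /cdist; have := rank_lt i; have := rank_lt j; have := rank_lt y.
by do 3 case: ifP; lia.
Qed.

Lemma cdist_sub e i j : i != j -> e != j -> cdist i j <= cdist i e ->
  cdist e i < cdist e j.
Proof.
rewrite -!(inj_eq rank_inj) /cdist.
have := rank_lt i; have := rank_lt j; have := rank_lt e.
by do 4 case: ifP; lia.
Qed.

Lemma cdist_before i j y : i != j -> cdist i j <= cdist i y ->
  cdist j y < cdist j i.
Proof.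
rewrite -!(inj_eq rank_inj) /cdist.
have := rank_lt i; have := rank_lt j; have := rank_lt y.
by do 4 case: ifP; lia.
Qed.

(** Intervals are indexed by their length rather than by their last element, so
    that in a component they need not end at an element of this component. *)
Definition window e k : pred E := fun y => 0 < cdist e y <= k.

Lemma window_self e k : window e k e = false.
Proof. by rewrite /window lt0n cdist_eq0 eqxx. Qed.

Lemma windowT e y : window e #|E| y = (y != e).
Proof. by rewrite /window lt0n cdist_eq0 ltnW ?cdist_lt ?andbT. Qed.

Lemma window0 e y : window e 0 y = false.
Proof. by rewrite /window; case: (cdist e y). Qed.

Lemma rank_succ e :
  rank (cyc_succ e) = if rank e < #|E|.-1 then (rank e).+1 else 0.
Proof.
have -> : rank (cyc_succ e) = (rank e).+1 %% #|E|.
  by rewrite /rank /cyc_succ Order.EnumVal.enum_valK.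
have lt1 := rank_lt e; case: ltnP => [lt2|le2].
  have lt3 : (rank e).+1 < #|E| by lia.
  exact: modn_small lt3.
have le3 : #|E| <= (rank e).+1 by lia.
have -> : (rank e).+1 = #|E| by apply/eqP; rewrite eqn_leq lt1.
exact: modnn.
Qed.

Lemma cyc_interval_window e x y : x != e ->
  (y \in cyc_interval (cyc_succ e) x) = window e (cdist e x) y.
Proof.
move=> xe; rewrite inE !cyc_leE /window.
move: xe; rewrite -(inj_eq rank_inj) /cdist rank_succ.
have := rank_lt x; have := rank_lt y; have := rank_lt e.
case: (leqP (rank e) (rank x)); case: (leqP (rank e) (rank y)) => /=;
  repeat (case: ifP => ?; rewrite ?leq0n ?leqnn ?subn0 /=); lia.
Qed.

Lemma cyc_min_window e (p : E) : p != e ->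
  cyc_min e [set x in ~: [set e] | window e (cdist e x) p] = Some p.
Proof.
move=> pe; rewrite /cyc_min.
have inS x : (x \in [set x in ~: [set e] | window e (cdist e x) p]) =
    (x != e) && (cdist e p <= cdist e x).
  by rewrite !inE /window lt0n cdist_eq0 pe.
case: pickP => [x|/(_ p)].
  rewrite inS => /andP[/andP[_ px] /forall_inP/(_ p)].
  rewrite inS pe leqnn cyc_leE => /(_ isT) xp.
  by congr Some; apply: (@cdist_inj e); apply/eqP; rewrite eqn_leq xp.
rewrite inS pe leqnn /= => /negP[]; apply/forall_inP => y.
by rewrite inS cyc_leE => /andP[].
Qed.

End CyclicOrder.

(** * Closure in the cycle matroid *)

Section CycleMatroidClosure.
Variables (E : finType) (G : graph E).
Implicit Types (F A B : {set E}) (e : E) (u v : vertex G).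

Lemma forest0 : forest G set0.
Proof. by move=> [[//|q c] _ cF]; have := cF q.2 (mem_head _ _); rewrite inE. Qed.

Lemma forest_extend A F : forest G F -> F \subset A ->
  exists B, [/\ forest G B, F \subset B, B \subset A &
    forall e, e \in A -> connect (@adj E G B) (ends G e).1 (ends G e).2].
Proof.
move=> fF FA.
have [|B mB FB] := @maxset_exists E (fun F => `[< forest G F >] && (F \subset A)) F.
  by rewrite FA andbT; apply/asboolP.
move/maxsetP: mB => [/andP[/asboolP fB BA] mB].
exists B; split => // e eA.
have [eB|eB] := boolP (e \in B).
  by apply/connect1/exists_inP; exists e => //; apply: joins_ends.
apply/negPn/negP => /negP ncon.
have H : e |: B = B.
  apply: mB; last exact: subsetUr.
  by rewrite subUset sub1set eA BA /= andbT; apply/asboolP/forestU1.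
by move: eB; rewrite -H setU11.
Qed.

Lemma connect_span F B u v :
  (forall e, e \in F -> connect (@adj E G B) (ends G e).1 (ends G e).2) ->
  connect (@adj E G F) u v -> connect (@adj E G B) u v.
Proof.
move=> H; apply: connect_sub => x y /exists_inP[e /H c].
by rewrite /joins => /orP[]/eqP eE; move: c; rewrite eE //= adj_csym.
Qed.

Lemma forest_maximal F : forest G F ->
  exists2 B, B \in maximal_forests G & F \subset B.
Proof.
move=> /(@forest_extend [set: E])[|B [fB FB _ cB]]; first exact: subsetT.
by exists B => //; apply/maximal_forestsP; split => // e; apply: cB; rewrite inE.
Qed.

Lemma mrank_ge F A : forest G F -> F \subset A -> #|F| <= mrank (cycle_matroid G) A.
Proof.
move=> /forest_maximal[B mB FB] FA.
apply: (@leq_trans #|A :&: B|); first by rewrite subset_leq_card ?subsetI ?FA.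
by rewrite /mrank (bigD1 B mB) leq_maxl.
Qed.

Lemma mrank_forest A : exists F,
  [/\ forest G F, F \subset A & #|F| = mrank (cycle_matroid G) A].
Proof.
have [B mB rE] : {B | B \in maximal_forests G &
    mrank (cycle_matroid G) A = #|A :&: B|}.
  apply: eq_bigmax_cond; rewrite card_gt0; exact: maximal_forests_neq0.
exists (A :&: B); split; [|exact: subsetIl|by rewrite rE].
by case/maximal_forestsP: mB => fB _; apply: forestS fB; apply: subsetIr.
Qed.

Lemma mclosure_connect A e : (e \in mclosure (cycle_matroid G) A) =
  connect (@adj E G A) (ends G e).1 (ends G e).2.
Proof.
have mono : mrank (cycle_matroid G) A <= mrank (cycle_matroid G) (e |: A).
  have [F [fF FA <-]] := mrank_forest A; apply: mrank_ge => //.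
  exact: subset_trans FA (subsetUr _ _).
rewrite inE; apply/idP/idP => [/eqP rE|con].
- apply/negPn/negP => /negP ncon.
  have [F [fF FA FE]] := mrank_forest A.
  have ncF : ~ connect (@adj E G F) (ends G e).1 (ends G e).2.
    by move=> c; apply: ncon; apply: connect_adjS c.
  have eF : e \notin F.
    apply/negP => eF; apply: ncF; apply/connect1/exists_inP.
    by exists e => //; apply: joins_ends.
  have := @mrank_ge (e |: F) (e |: A) (forestU1 fF eF ncF) (setUS _ FA).
  by rewrite cardsU1 eF rE -FE ltnn.
- rewrite eqn_leq mono andbT.
  (* If a maximum forest F of e |: A uses e, then the forest F :\ e is not
     maximal in A, since it does not connect the ends of e while A does. *)
  have [F [fF FA <-]] := mrank_forest (e |: A).
  have [eF|eF] := boolP (e \in F); last first.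
    apply: mrank_ge => //; apply/subsetP => x xF.
    move: (subsetP FA x xF); rewrite !inE => /predU1P[xe|//].
    by rewrite -xe xF in eF.
  have JA : F :\ e \subset A.
    apply/subsetP => x; rewrite !inE => /andP[xe /(subsetP FA)].
    by rewrite !inE (negPf xe).
  have fJ : forest G (F :\ e) by apply: forestS fF; apply: subD1set.
  have [B [fB JB BA cB]] := forest_extend fJ JA.
  apply: leq_trans (mrank_ge fB BA).
  rewrite (cardsD1 e) eF add1n; apply: proper_card.
  rewrite properEneq JB andbT; apply/eqP => BE.
  apply: (forestD1 fF eF); rewrite BE; exact: connect_span cB con.
Qed.

Lemma mcoloop_connect e : mcoloop (cycle_matroid G) e =
  ~~ connect (@adj E G (~: [set e])) (ends G e).1 (ends G e).2.
Proof.
apply/forall_inP/idP => [H|/negP ncon B /maximal_forestsP[_ cB]].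
  apply/negP => con.
  have [B [fB _ BA cB]] := forest_extend forest0 (sub0set (~: [set e])).
  have : B \in maximal_forests G.
    apply/maximal_forestsP; split => // f.
    have [->|fe] := eqVneq f e; first exact: connect_span cB con.
    by apply: cB; rewrite !inE.
  by move=> /H /(subsetP BA); rewrite !inE eqxx.
apply/negPn/negP => eB; apply: ncon; apply: connect_adjS (cB e).
by apply/subsetP => x xB; rewrite !inE; apply: contraNneq eB => <-.
Qed.

Lemma mloop_ends e : mloop (cycle_matroid G) e = ((ends G e).1 == (ends G e).2).
Proof.
have con0 : connect (@adj E G set0) (ends G e).1 (ends G e).2 ->
    (ends G e).1 = (ends G e).2.
  case/connectP => [[|y p] /=]; first by move=> _ ->.
  by case/andP => /exists_inP[a]; rewrite inE.
apply/forall_inP/eqP => [H|eE B /maximal_forestsP[fB _]]; last first.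
  apply/negP => eB; apply: (forestD1 fB eB); rewrite eE; exact: connect0.
apply/eqP/negPn/negP => /eqP ne.
have [|B mB] := @forest_maximal [set e].
  rewrite -(setU0 [set e]); apply: forestU1; [exact: forest0|by rewrite inE|].
  by move=> /con0.
by rewrite sub1set => eB; have := H B mB; rewrite eB.
Qed.

(** For the converse, take as potential the indicator function of the
    component of [u]. *)
Lemma connect_potential F u v : reflect
  (forall p : vertex G -> bool,
     (forall e, e \in F -> p (ends G e).1 = p (ends G e).2) -> p u = p v)
  (connect (@adj E G F) u v).
Proof.
apply: (iffP idP) => [/connectP[q qP ->] p pF|H]; last first.
  rewrite -(H (connect (@adj E G F) u)) ?connect0 // => e eF.
  apply: same_connect_r; first exact: adj_csym.
  by apply/connect1/exists_inP; exists e => //; apply: joins_ends.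
elim: q u qP => //= w q IH u /andP[/exists_inP[e /pF pe J] /IH <-].
by move: J pe; rewrite /joins => /orP[]/eqP-> /=.
Qed.

End CycleMatroidClosure.

(** * Series-parallel networks and their cuts *)

Section SeriesParallel.
Variable E : eqType.
Implicit Types (a e : E) (k : E -> bool).

Inductive spnet := Leaf of E | Ser of spnet & spnet | Par of spnet & spnet.
Implicit Types (s t : spnet).

Fixpoint edges t : seq E :=
  match t with
  | Leaf e => [:: e]
  | Ser s t | Par s t => edges s ++ edges t
  end.

(** Read [k e] as the potential difference (mod 2) between the ends of [e].  The
    condition for [k] to come from a potential on the vertices is [cut t k], and
    then [volt t k] is the potential difference between the terminals.  The
    network closed by an extra root edge [e] thus has the cuts [k] such that
    [cut t k] and [volt t k = k e]. *)
Fixpoint volt t k : bool :=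
  match t with
  | Leaf e => k e
  | Ser s t => volt s k (+) volt t k
  | Par s t => volt s k
  end.

Fixpoint cut t k : bool :=
  match t with
  | Leaf e => true
  | Ser s t => cut s k && cut t k
  | Par s t => [&& cut s k, cut t k & volt s k == volt t k]
  end.

Fixpoint subst a s t : spnet :=
  match t with
  | Leaf e => if e == a then s else t
  | Ser t1 t2 => Ser (subst a s t1) (subst a s t2)
  | Par t1 t2 => Par (subst a s t1) (subst a s t2)
  end.

Definition upd k a (b : bool) : E -> bool := fun x => if x == a then b else k x.

Lemma eq_volt t k k' : {in edges t, k =1 k'} -> volt t k = volt t k'.
Proof.
elim: t => [e|s IHs t IHt|s IHs t IHt] /= H; first by apply: H; rewrite inE.
- by rewrite IHs ?IHt // => x xs; apply: H; rewrite mem_cat xs ?orbT.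
- by rewrite IHs // => x xs; apply: H; rewrite mem_cat xs.
Qed.

Lemma eq_cut t k k' : {in edges t, k =1 k'} -> cut t k = cut t k'.
Proof.
elim: t => [e|s IHs t IHt|s IHs t IHt] //= H;
  have Hs : {in edges s, k =1 k'} by move=> x xs; apply: H; rewrite mem_cat xs.
all: have Ht : {in edges t, k =1 k'}
  by move=> x xs; apply: H; rewrite mem_cat xs orbT.
all: by rewrite IHs ?IHt // ?(eq_volt Hs) ?(eq_volt Ht).
Qed.

Lemma volt0 t : volt t (fun=> false) = false.
Proof. by elim: t => [e|s IHs t IHt|s IHs t IHt] //=; rewrite IHs ?IHt. Qed.

Lemma cut0 t : cut t (fun=> false).
Proof.
by elim: t => [e|s IHs t IHt|s IHs t IHt] //=; rewrite IHs IHt ?volt0.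
Qed.

Lemma volt_subst a s t k : volt (subst a s t) k = volt t (upd k a (volt s k)).
Proof.
elim: t => [e|t1 IH1 t2 IH2|t1 IH1 t2 IH2] /=; rewrite ?IH1 ?IH2 //.
by rewrite /upd; case: eqP.
Qed.

Lemma cut_subst a s t k : cut (subst a s t) k =
  cut t (upd k a (volt s k)) && ((a \in edges t) ==> cut s k).
Proof.
elim: t => [e|t1 IH1 t2 IH2|t1 IH1 t2 IH2] /=.
- by rewrite inE eq_sym; case: eqP.
- by rewrite IH1 IH2 mem_cat; do 2 case: (a \in _); do 3 case: (cut _ _).
- rewrite IH1 IH2 !volt_subst mem_cat.
  by do 2 case: (a \in _); do 3 case: (cut _ _); case: (_ == _).
Qed.

Lemma count_edges_subst (P : pred E) a s t : count P (edges (subst a s t)) =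
  count_mem a (edges t) * count P (edges s)
    + count (predI P (predC1 a)) (edges t).
Proof.
elim: t => [e|t1 IH1 t2 IH2|t1 IH1 t2 IH2] /=.
- by case: (eqVneq e a) => [_|_] /=; rewrite ?andbF ?andbT; lia.
- by rewrite !count_cat IH1 IH2; lia.
- by rewrite !count_cat IH1 IH2; lia.
Qed.

Lemma count_predC1 (P : pred E) a (s : seq E) :
  count (predI P (predC1 a)) s + P a * count_mem a s = count P s.
Proof.
elim: s => [|e s IH] /=; first by rewrite muln0.
by rewrite -IH; case: (eqVneq e a) => [->|_] /=; rewrite ?andbF ?andbT; lia.
Qed.

Lemma edges_subst a s t (r c1 c2 : seq E) : uniq (a :: c1) -> 
  perm_eq (r ++ edges t) (a :: c1) -> a \notin r ->
  perm_eq (edges s) (a :: c2) -> perm_eq (r ++ edges (subst a s t)) (a :: c1 ++ c2).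
Proof.
move=> /= /andP[/count_memPn a0 _] /seq.permP tE /count_memPn ar /seq.permP sE.
apply/seq.permP => P; have := tE P; have := tE (pred1 a); have := sE P.
rewrite /= !count_cat count_edges_subst -(count_predC1 P a (edges t)) eqxx a0 ar.
move=> -> /=; rewrite add0n addn0 => ->; lia.
Qed.

End SeriesParallel.

Arguments edges {E} t.

(** * Sliding an edge along another *)

Section CutSpaces.
Variables (d : Order.disp_t) (E : finOrderType d).
Implicit Types (e i j x y : E) (c : seq E) (K : (E -> bool) -> bool).
Implicit Types (k : E -> bool) (f g : E -> E).

(** [K] stands for the space of cuts of a matroid on [c]: [e] is in the closure
    of [F] iff each cut that vanishes on [F] vanishes at [e]. *)
Definition spans K c (F : pred E) e : Prop :=
  forall k, K k -> {in c, forall y, F y -> k y = false} -> k e = false.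

(** With [n] the distance from [e] to [x], this says that [e] is in the closure of
    [[e+1, x]] iff [f e] is in this interval.  A fixed point of [f] has to be a
    coloop. *)
Definition realizes K c f : Prop := {in c, forall e n,
  spans K c (window e n) e <-> window e n (f e)}.

Definition local K c : Prop :=
  forall k k', {in c, k =1 k'} -> K k = K k'.

(** The cuts of the direct sum after the replacement of the vector [v_j] by
    [v_j + v_i]: evaluating a functional at the old vector [v_j] amounts to
    adding its values at [j] and [i]. *)
Definition slide K1 K2 i j k := K1 k && K2 (upd k j (k j (+) k i)).

Section Slide.
Variables (c1 c2 c : seq E) (K1 K2 : (E -> bool) -> bool) (i j : E).
Hypotheses (ic1 : i \in c1) (jc2 : j \in c2).
Hypothesis c12 : {in c1, forall x, x \notin c2}.
Hypothesis cE : c =i [predU c1 & c2].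
Hypotheses (loc1 : local K1 c1) (loc2 : local K2 c2).
Hypotheses (K10 : K1 (fun=> false)) (K20 : K2 (fun=> false)).

Let K := slide K1 K2 i j.

Lemma mem_c1 x : x \in c1 -> x \in c.
Proof. by rewrite cE inE => ->. Qed.

Lemma mem_c2 x : x \in c2 -> x \in c.
Proof. by rewrite cE inE => ->; rewrite orbT. Qed.

Lemma c2_c1 x : x \in c2 -> (x \in c1) = false.
Proof. by move=> x2; apply/negP => /c12; rewrite x2. Qed.

Lemma c1_neq_j x : x \in c1 -> x != j.
Proof. by apply: contraTneq => ->; rewrite c2_c1. Qed.

Lemma c2_neq_i x : x \in c2 -> x != i.
Proof. by move=> x2; apply: contraTneq ic1 => <-; rewrite c2_c1. Qed.

Lemma slide_glue k1 k2 : K1 k1 -> K2 k2 -> exists2 k, K k &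
  {in c1, k =1 k1} /\ {in c2, forall y, k y = k2 y (+) ((y == j) && k1 i)}.
Proof.
move=> H1 H2; set k := fun y => if y \in c1 then k1 y
                               else k2 y (+) ((y == j) && k1 i).
have kc1 : {in c1, k =1 k1} by move=> y y1; rewrite /k y1.
exists k; last by split=> // y y2; rewrite /k c2_c1.
apply/andP; split; first by rewrite (loc1 kc1).
rewrite (@loc2 _ k2) // => y y2; rewrite /upd (kc1 i ic1).
case: eqP => [->|/eqP yj]; first by rewrite /k c2_c1 // eqxx addbK.
by rewrite /k c2_c1 // (negPf yj) addbF.
Qed.

(** The closure is that of the direct sum when the span of [F] has not changed,
    which is the case if [F] contains [i] or does not contain [j]. *)
Lemma spans_slide1 (F : pred E) e : e \in c1 -> (F j -> F i) ->
  spans K c F e <-> spans K1 c1 F e.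
Proof.
move=> e1 Fji; split => H k.
  move=> /slide_glue/(_ K20)[k' Kk' [k1 k2]] kF; rewrite -k1 //.
  apply: H Kk' _ => y; rewrite cE inE => /orP[y1 /(kF _ y1)|y2 Fy].
    by rewrite k1.
  rewrite k2 //; case: eqP Fy => //= -> /Fji /(kF _ ic1) ->.
  by [].
move=> /andP[Kk _] kF; apply: H Kk _ => y /mem_c1; exact: kF.
Qed.

Lemma spans_slide2 (F : pred E) e : e \in c2 -> e != j -> (F j -> F i) ->
  spans K c F e <-> spans K2 c2 F e.
Proof.
move=> e2 ej Fji; split => H k.
  move=> /(slide_glue K10)[k' Kk' [k1 k2]] kF.
  have k2E y : y \in c2 -> k' y = k y by move=> /k2 ->; rewrite andbF addbF.
  rewrite -k2E //; apply: H Kk' _ => y; rewrite cE inE => /orP[y1|y2] Fy.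
    by rewrite k1.
  by rewrite k2E // kF.
move=> /andP[_ Kk] kF.
suff: upd k j (k j (+) k i) e = false by rewrite /upd (negPf ej).
apply: H Kk _ => y y2 Fy; rewrite /upd; case: eqP Fy => [-> Fj|_].
  by have -> := kF j (mem_c2 jc2) Fj; have -> := kF i (mem_c1 ic1) (Fji Fj).
by apply: kF; rewrite mem_c2.
Qed.

(** If [F] contains [v_j + v_i], it spans [v_i] as soon as it spans the old
    [v_j].  Conversely, cuts of the two summands that are nonzero at [i] and at
    [j] glue to a cut of the slide that vanishes at [j]. *)
Lemma spans_slide_i (F F' : pred E) : F j -> F i = false ->
  {in c2, forall y, F' y = (y != j) && F y} ->
  spans K c F i <-> spans K1 c1 F i \/ spans K2 c2 F' j.
Proof.
move=> Fj Fi F'E; split=> [H|[H|H]].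
- apply: contrapT => /not_orP[/existsNP[k1]].
  move=> /not_implyP[Kk1 /not_implyP[kF1 /eqP]]; rewrite eqbF_neg negbK => k1i.
  case/existsNP => k2 /not_implyP[Kk2 /not_implyP[kF2 /eqP]].
  rewrite eqbF_neg negbK => k2j.
  have [k Kk [e1 e2]] := slide_glue Kk1 Kk2.
  suff : k i = false by rewrite e1 // k1i.
  apply: H Kk _ => y; rewrite cE inE => /orP[y1|y2] Fy.
    by rewrite e1 // kF1.
  rewrite e2 //; case: (eqVneq y j) => [->|yj]; first by rewrite k1i k2j.
  by rewrite addbF kF2 // F'E // yj.
- move=> k /andP[Kk _] kF; apply: H Kk _ => y /mem_c1; exact: kF.
- move=> k /andP[_ Kk] kF.
  have kj : k j = false by apply: kF => //; rewrite mem_c2.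
  suff: upd k j (k j (+) k i) j = false by rewrite /upd eqxx kj.
  apply: H Kk _ => y y2; rewrite F'E // /upd => /andP[/negPf ->].
  by apply: kF; rewrite mem_c2.
Qed.

(** In a direct sum, [v_j + v_i] is spanned only if [v_i] and [v_j] are. *)
Lemma spans_slide_j (F : pred E) : F i = false -> F j = false ->
  spans K c F j <-> spans K1 c1 F i /\ spans K2 c2 F j.
Proof.
move=> Fi Fj; split=> [H|[H1 H2]].
  split=> k Kk kF.
    have [k' Kk' [e1 e2]] := slide_glue Kk K20.
    suff : k' j = false by rewrite e2 // eqxx.
    apply: H Kk' _ => y; rewrite cE inE => /orP[y1|y2] Fy.
      by rewrite e1 // kF.
    by rewrite e2 //; case: eqP Fy => // ->; rewrite Fj.
  have [k' Kk' [e1 e2]] := slide_glue K10 Kk.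
  have e2' y : y \in c2 -> k' y = k y by move=> /e2 ->; rewrite andbF addbF.
  rewrite -e2' //; apply: H Kk' _ => y; rewrite cE inE => /orP[y1|y2] Fy.
    by rewrite e1.
  by rewrite e2' // kF.
move=> k /andP[Kk1 Kk2] kF.
have ki : k i = false by apply: H1 Kk1 _ => y /mem_c1; exact: kF.
suff: upd k j (k j (+) k i) j = false by rewrite /upd eqxx ki addbF.
apply: H2 Kk2 _ => y y2 Fy; rewrite /upd; case: eqP Fy => [->|_]; rewrite ?Fj //.
by apply: kF; rewrite mem_c2.
Qed.

Lemma spans_slide_ji (F : pred E) : F i -> spans K2 c2 F j -> spans K c F j.
Proof.
move=> Fi H k /andP[_ Kk] kF.
have ki : k i = false by apply: kF => //; rewrite mem_c1.
suff: upd k j (k j (+) k i) j = false by rewrite /upd eqxx ki addbF.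
apply: H Kk _ => y y2 Fy; rewrite /upd; case: eqP Fy => [-> Fj|_].
  by rewrite ki addbF kF ?mem_c2.
by apply: kF; rewrite mem_c2.
Qed.

Variables f g : E -> E.
Hypothesis f_in : {in c, forall x, f x \in c}.
Hypothesis f_neq : {in c, forall x, f x != x}.
Hypotheses (gi : g i = f j) (gj : g j = f i).
Hypothesis gE : {in c, forall x, x != i -> x != j -> g x = f x}.
Hypothesis consec : {in c, forall y, y != i -> cdist i j <= cdist i y}.
Hypothesis crossing : cdist j (f i) < cdist j (f j).
Hypothesis loop_j : f i = j -> {in c2, forall e, e = j}.
Hypothesis real1 : realizes K1 c1 g.
(** The summand of [j] may consist of a loop, which is in the closure of
    everything; the summand of [i] may consist of a coloop, and then
    [window i n (g i)] is false as it should be. *)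
Hypothesis real2 : {in c2, forall e n,
  spans K2 c2 (window e n) e <-> (f i == j) || window e n (g e)}.

Lemma ij : i != j. Proof. exact: c1_neq_j. Qed.

Lemma cdist_via_j y : y \in c -> y != i -> cdist i y = cdist i j + cdist j y.
Proof. by move=> yc yi; apply: cdist_add; apply: consec. Qed.

Lemma cdist_j_i y : y \in c -> y != i -> cdist j y < cdist j i.
Proof.
by move=> yc yi; apply: cdist_before; rewrite ?ij // consec.
Qed.

(** Away from [i] and [j], no window separates [i] from [j] by containing [j]
    only.  For [e = i] the closure condition is the disjunction of those for [i]
    and [j] in the summands, so the first of [f i] and [f j] counts; for [e = j]
    it is their conjunction, so the last one counts.  By [crossing] these are
    [f i] and [f j] respectively. *)
Lemma slide_realizes : realizes K c f.
Proof.
have ic := mem_c1 ic1; have jc := mem_c2 jc2.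
have dij : 0 < cdist i j by rewrite lt0n cdist_eq0 eq_sym ij.
have fic := f_in ic; have fjc := f_in jc.
have fii := f_neq ic; have fjj := f_neq jc.
have wi n y : y \in c -> y != i ->
    window i n y = (cdist i j + cdist j y <= n).
  by move=> yc yi; rewrite /window cdist_via_j // addn_gt0 dij.
have wj n y : y != j -> window j n y = (cdist j y <= n).
  by move=> yj; rewrite /window lt0n cdist_eq0 yj.
move=> e ec n; have [->{e ec}|ei] := eqVneq e i.
  case: (leqP (cdist i j) n) => dn; last first.
    (* The window stops before j, so it contains no element of c. *)
    have w0 y : y \in c -> window i n y = false.
      move=> yc; case: (eqVneq y i) => [->|yi]; first by rewrite window_self.
      by rewrite wi //; clear -dn; lia.
    have -> : window i n (f i) = window i n (g i) by rewrite gi !w0.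
    by rewrite -real1 //; apply: spans_slide1 => //; rewrite w0.
  have wij : window i n j by rewrite /window dij.
  have F'E : {in c2, forall y, window j (n - cdist i j) y =
      (y != j) && window i n y}.
    move=> y y2; case: (eqVneq y j) => [->|yj]; first by rewrite window_self.
    by rewrite (wj _ _ yj) (wi _ _ (mem_c2 y2) (c2_neq_i y2)) leq_subRL.
  rewrite (spans_slide_i wij (window_self _ _) F'E) real1 // real2 // gi gj.
  rewrite (wi n (f i)) //; case: (eqVneq (f i) j) => [->|fij] /=.
    by rewrite (eqP (_ : cdist j j == 0)) ?cdist_eq0 // addn0; split=> // _; right.
  rewrite wj //; case: (eqVneq (f j) i) => [->|fji].
    rewrite window_self; clear -dn; split=> [[//|]|H]; last right; lia.
  rewrite wi //; move: crossing; clear -dn => cr.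
  by split=> [[]|H]; last right; lia.
have [->{e ec ei}|ej] := eqVneq e j.
  case: (leqP (cdist j i) n) => dn.
    (* The window contains i, hence all of c except j, and both sides hold. *)
    have wji : window j n i by rewrite wj ?ij.
    have -> : window j n (f j).
      rewrite wj //; case: (eqVneq (f j) i) => [->//|fji].
      by apply: ltnW; apply: leq_trans dn; apply: cdist_j_i.
    split=> // _; apply: spans_slide_ji => //; apply/real2 => //; rewrite gj.
    case: (eqVneq (f i) j) => //= fij.
    by rewrite wj //; apply: ltnW; apply: leq_trans dn; apply: cdist_j_i.
  have wji : window j n i = false by rewrite wj ?ij // leqNgt dn.
  rewrite (spans_slide_j wji (window_self _ _)) real2 // gj.
  have -> : spans K1 c1 (window j n) i <-> spans K1 c1 (window i (n + cdist i j)) i.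
    have wE : {in c1, forall y, window j n y = window i (n + cdist i j) y}.
      move=> y y1; case: (eqVneq y i) => [->|yi]; first by rewrite window_self.
      by rewrite wi ?mem_c1 // wj ?c1_neq_j // addnC leq_add2r.
    by split=> H k Kk kF; apply: H Kk _ => y y1; move: (kF y y1); rewrite wE.
  rewrite real1 // gi; case: (eqVneq (f j) i) => [->|fji].
    by rewrite window_self wji; split=> // -[].
  rewrite wi // (wj _ (f j)) // addnC leq_add2r.
  case: (eqVneq (f i) j) => [_|fij] /=; first by split=> [[]|].
  rewrite wj //; split=> [[]//|H]; split=> //; apply: leq_trans H; exact: ltnW.
have Fji : window e n j -> window e n i.
  rewrite /window => /andP[_ H]; rewrite lt0n cdist_eq0 eq_sym ei /=.
  apply: leq_trans H; apply/ltnW/cdist_sub; rewrite ?ij //; exact: consec.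
rewrite -gE //; move: ec; rewrite cE inE => /orP[e1|e2].
  by rewrite -real1 //; apply: spans_slide1.
rewrite (spans_slide2 e2 ej Fji) real2 //.
by case: eqP => // /loop_j/(_ e e2) H; rewrite H eqxx in ej.
Qed.

End Slide.
End CutSpaces.

(** * A network for each cycle *)

Section CycleNetwork.
Variables (d : Order.disp_t) (E : finOrderType d).
Implicit Types (e i j x y : E) (c : seq E) (K : (E -> bool) -> bool).
Implicit Types (k : E -> bool) (f g : E -> E) (s t : spnet E).

(** [K] is the space of cuts of the network [t] closed by the edge [e]. *)
Definition rooted_at K c e : Prop := exists2 t, perm_eq (e :: edges t) c &
  forall k, K k = cut t k && (volt t k == k e).

Lemma rooted_local K c e : rooted_at K c e -> local K c.
Proof.
move=> [t tE KE] k k' kk'; have tc x : x \in edges t -> x \in c.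
  by move=> xt; rewrite -(perm_mem tE) inE xt orbT.
rewrite !KE (@eq_cut _ t k k') ?(@eq_volt _ t k k') ?kk' //.
- by rewrite -(perm_mem tE) mem_head.
- by move=> x /tc/kk'.
- by move=> x /tc/kk'.
Qed.

Lemma rooted_zero K c e : rooted_at K c e -> K (fun=> false).
Proof. by move=> [t _ ->]; rewrite cut0 volt0. Qed.

Lemma cut_local t c : perm_eq (edges t) c -> local (cut t) c.
Proof. by move=> tE k k' kk'; apply: eq_cut => x; rewrite (perm_mem tE) => /kk'. Qed.

Lemma path_rcons_eq f g u v A x : g u = f v -> {in A, g =1 f} ->
  path (frel f) v (rcons A x) -> path (frel g) u (rcons A x).
Proof.
elim: A u v => [|a A IH] u v /= guv gf; first by rewrite guv.
rewrite guv => /andP[-> pA] /=; apply: (IH a a) pA; first by rewrite gf ?mem_head.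
by move=> y yA; apply: gf; rewrite inE yA orbT.
Qed.

Lemma coloop_realizes f i : f i = i -> realizes (fun=> true) [:: i] f.
Proof.
move=> fi e; rewrite inE => /eqP-> n; rewrite fi window_self; split=> // H.
have : (i == i) = false; last by rewrite eqxx.
apply: (H (fun x => x == i)) => // y.
by rewrite inE => /eqP->; rewrite window_self.
Qed.

(** The component of [i] before the slide.  A single element is a coloop, which
    is no network closed by a root edge; the last two clauses hide this special
    case.  [P] is the component as a network between the ends of [i], and the
    last clause roots at [i] the network obtained when [s] comes in parallel
    with it: [s] in parallel with the rest of the component, or [s] alone. *)
Lemma parallel_component g i B : uniq (i :: B) ->
  (B = [::] -> g i = i) ->
  (B <> [::] -> exists2 K, realizes K (i :: B) g &
     {in i :: B, forall e, rooted_at K (i :: B) e}) ->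
  exists K P, [/\ realizes K (i :: B) g, perm_eq (edges P) (i :: B),
    forall k, K k = cut P k /\ volt P k = k i,
    {in B, forall e, rooted_at K (i :: B) e} &
    forall s, exists2 t, perm_eq (edges t) (B ++ edges s) & forall k,
      cut t k && (volt t k == k i) = K k && (cut s k && (volt s k == k i))].
Proof.
case: B => [|b B] uB gi IH.
  exists (fun=> true), (Leaf i); split=> //; last by move=> s; exists s.
  exact/coloop_realizes/gi.
have [//|K Kr KR] := IH; have [t tE KE] := KR i (mem_head _ _).
have tB : perm_eq (edges t) (b :: B) by rewrite -(perm_cons i).
exists K, (Par (Leaf i) t); split=> //=.
- by move=> k; rewrite KE eq_sym.
- by move=> e eB; apply: KR; rewrite inE eB orbT.
- move=> s; exists (Par t s) => [|k].
    by move: tB; rewrite -(perm_cat2r (edges s)).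
  rewrite KE /=; case: (cut t k); case: (cut s k) => //=; rewrite ?andbF //.
  by case: (volt t k); case: (volt s k); case: (k i).
Qed.

(** The component of [j] before the slide, dual to the previous one: a single
    element is a loop.  [S] is the path made of the slid edge [j] and the rest of
    the component, which has the potential difference [b] that [j] had before.
    The last clause roots at [j] the ring of [j], the rest of the component and
    [s]. *)
Lemma series_component g j A : uniq (j :: A) ->
  (A <> [::] -> exists2 K, realizes K (j :: A) g &
     {in j :: A, forall e, rooted_at K (j :: A) e}) ->
  exists K S, [/\ {in j :: A, forall e n, spans K (j :: A) (window e n) e <->
                    (A == [::]) || window e n (g e)},
    perm_eq (edges S) (j :: A),
    [/\ local K (j :: A), K (fun=> false) & forall k b,
      K (upd k j b) = cut S k && (volt S k == k j (+) b)],
    {in A, forall e, rooted_at K (j :: A) e} &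
    forall s, exists2 t, perm_eq (edges t) (A ++ edges s) & forall k,
      cut t k && (volt t k == k j) = cut s k && K (upd k j (k j (+) volt s k))].
Proof.
case: A => [|a A] uA IH.
  exists (fun k => ~~ k j), (Leaf j); split=> //.
  - by move=> e; rewrite inE => /eqP-> n; split=> // _ k /negbTE.
  - split=> // [k k' ->|k b]; rewrite ?mem_head //.
    by rewrite /upd eqxx /=; case: (k j); case: b.
  - move=> s; exists s => // k; rewrite /upd eqxx.
    by case: (k j); case: (volt s k).
have [//|K Kr KR] := IH; have [t tE KE] := KR j (mem_head _ _).
have tA : perm_eq (edges t) (a :: A) by rewrite -(perm_cons j).
have Ku k b : K (upd k j b) = cut t k && (volt t k == b).
  have jk : {in edges t, upd k j b =1 k}.
    move=> x; rewrite (perm_mem tA) /upd; case: eqP => // -> jA.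
    by case/andP: uA; rewrite jA.
  by rewrite KE (eq_cut jk) (eq_volt jk) /upd eqxx.
exists K, (Ser (Leaf j) t); split=> //=.
- split; [exact: rooted_local (KR j (mem_head _ _))
         | exact: rooted_zero (KR j (mem_head _ _)) | move=> k b].
  by rewrite Ku; case: (k j); case: b; case: (volt t k).
- by move=> e eA; apply: KR; rewrite inE eA orbT.
- move=> s; exists (Ser t s) => [|k].
    by move: tA; rewrite -(perm_cat2r (edges s)).
  rewrite Ku /=; case: (cut t k); case: (cut s k) => //=.
  by case: (volt t k); case: (volt s k); case: (k j).
Qed.

(** By induction on the size of the cycle, splitting it with the slide of an edge
    and rooting the result at each edge. *)
Theorem cycle_network f c : 1 < size c -> uniq c -> cycle (frel f) c ->
  {in c, forall x, f x != x} ->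
  exists2 K, realizes K c f & {in c, forall e, rooted_at K c e}.
Proof.
have [n] := ubnP (size c); elim: n c f => // n IH c f le_n c2 uc cyc_c fx.
have f_in : {in c, forall x, f x \in c}.
  by move=> x xc; rewrite (eqP (next_cycle cyc_c xc)) mem_next.
have [x0 x0c] : exists x0, x0 \in c.
  by case: (c) c2 => // x s _; exists x; rewrite mem_head.
case: (arg_minnP (fun x => cdist x (f x)) x0c) => i ic i_min.
(* With i at minimal distance from its image and j next to i in c, the image of
   j lies beyond that of i as seen from j: the slide has the required crossing. *)
have [r s cE] := rot_to ic.
have cs : perm_eq c (i :: s) by rewrite -cE perm_sym perm_rot.
have {cE} cyc_s : cycle (frel f) (i :: s) by rewrite -cE rot_cycle.
have us : uniq (i :: s) by rewrite -(perm_uniq cs).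
have [y0 y0s] : exists y0, y0 \in s.
  case: (s) (perm_size cs) c2 => [->//|y s' _ _]; exists y; exact: mem_head.
case: (arg_minnP (cdist i) y0s) => j js j_min.
case/splitPr: js => A B in cs cyc_s us y0s j_min *.
have cs' : perm_eq c ((i :: B) ++ (j :: A)).
  rewrite (perm_trans cs) //= perm_cons; apply/seq.permP => P.
  by rewrite !count_cat /=; lia.
have := uc; rewrite (perm_uniq cs') cat_uniq => /and3P[uB /hasPn disj uA].
have cmem : c =i [predU i :: B & j :: A].
  by move=> x; rewrite (perm_mem cs') mem_cat.
have jc : j \in c by rewrite cmem inE mem_head orbT.
have i_neq_j : i != j.
  by apply: contraNneq (disj j (mem_head _ _)) => ->; rewrite mem_head.
have [pA pB] : path (frel f) i (rcons A j) /\ path (frel f) j (rcons B i).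
  apply/andP; move: cyc_s; rewrite /cycle rcons_cat rcons_cons -cat_rcons.
  by rewrite cat_path last_rcons.
have fA : (A == [::]) = (f i == j).
  case: (A) pA uA => [|a A'] /= /andP[/eqP-> _]; first by rewrite !eqxx.
  by rewrite inE negb_or [j == a]eq_sym => /andP[/andP[/negPf->]].
have fB : (B == [::]) = (f j == i).
  case: (B) pB uB => [|b B'] /= /andP[/eqP-> _]; first by rewrite !eqxx.
  by rewrite inE negb_or [i == b]eq_sym => /andP[/andP[/negPf->]].
pose g x := if x == i then f j else if x == j then f i else f x.
have gi : g i = f j by rewrite /g eqxx.
have gj : g j = f i by rewrite /g eqxx eq_sym (negPf i_neq_j).
have gE x : x != i -> x != j -> g x = f x by rewrite /g => /negPf-> /negPf->.
have gA : {in A, g =1 f}.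
  move=> x xA; apply: gE; last by apply: contraTneq xA => ->; case/andP: uA.
  apply: contraTneq xA => ->; have := disj i; rewrite !inE eqxx /=.
  by case: (i \in A); rewrite ?orbT // => /(_ isT).
have gB : {in B, g =1 f}.
  move=> x xB; apply: gE; first by apply: contraTneq xB => ->; case/andP: uB.
  apply: contraTneq xB => ->; have := disj j; rewrite !inE eqxx /=.
  by rewrite negb_or => /(_ isT)/andP[].
have szc := perm_size cs'; rewrite size_cat /= in szc.
have [||K1 [P1 [r1 eP1 cP1 R1 T1]]] := @parallel_component g i B uB.
- by move=> /eqP; rewrite fB gi => /eqP.
- move=> /eqP Bn; apply: IH => //=.
  + by move: le_n; rewrite szc; clear; lia.
  + by rewrite ltnS lt0n size_eq0.
  + exact: path_rcons_eq gi gB pB.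
  + move=> x; rewrite inE => /predU1P[->|xB]; first by rewrite gi -fB.
    by rewrite gB // fx // cmem !inE xB orbT.
have [|K2 [S2 [r2 eS2 [loc2 K20 KS2] R2 T2]]] := @series_component g j A uA.
  move=> /eqP An; apply: IH => //=.
  + by move: le_n; rewrite szc; clear; lia.
  + by rewrite ltnS lt0n size_eq0.
  + exact: path_rcons_eq gj gA pA.
  + move=> x; rewrite inE => /predU1P[->|xA]; first by rewrite gj -fA.
    by rewrite gA // fx // cmem !inE xA !orbT.
have loc1 : local K1 (i :: B).
  by move=> k k' kk'; rewrite !(cP1 _).1; apply: (cut_local eP1) kk'.
have K10 : K1 (fun=> false) by rewrite (cP1 _).1 cut0.
have consec : {in c, forall y, y != i -> cdist i j <= cdist i y}.
  move=> y; rewrite (perm_mem cs) inE => /predU1P[->|]; first by rewrite eqxx.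
  by move=> yAB _; apply: j_min.
exists (slide K1 K2 i j).
  apply: (@slide_realizes _ _ (i :: B) (j :: A) _ _ _ _ _ _ _ _ _ _ _ _ _ f g) => //.
  - exact: mem_head.
  - exact: mem_head.
  - by move=> x xB; apply: contraL xB => /disj.
  - by move=> x _; apply: gE.
  - have := i_min j jc; rewrite (@cdist_add _ _ i j (f i)).
      have : 0 < cdist i j by rewrite lt0n cdist_eq0 eq_sym.
      by clear; lia.
    by apply: consec; [exact: f_in | exact: fx].
  - by move=> /eqP; rewrite -fA => /eqP-> e; rewrite inE => /eqP.
  - by move=> e eA m; rewrite -fA; apply: r2.
move=> e; rewrite cmem !inE => /orP[/predU1P[->|eB]|/predU1P[->|eA]].
- have [t tE tK] := T1 S2; exists t.
    rewrite perm_sym (perm_trans cs') //= perm_cons perm_sym.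
    by rewrite (perm_trans tE) // perm_cat2l.
  by move=> k; rewrite tK /slide KS2 addbA addbb.
(* In the first component rooted at e, the edge i gets the path S2 in parallel;
   in the second one, the edge j becomes the slid edge j followed by P1. *)
- have [t eT tK] := R1 e eB; exists (subst i (Par (Leaf i) S2) t).
    rewrite perm_sym (perm_trans cs') // perm_sym.
    apply: (@edges_subst _ i _ _ [:: e] B (j :: A) uB eT).
      by rewrite inE; apply: contraTneq eB => <-; case/andP: uB.
    by rewrite /= perm_cons.
  have it : i \in edges t.
    have : i \in e :: edges t by rewrite (perm_mem eT) mem_head.
    by rewrite inE => /predU1P[ie|//]; case/andP: uB; rewrite ie eB.
  have ik k : {in edges t, upd k i (k i) =1 k}.
    by move=> x _; rewrite /upd; case: eqP => [->|].
  move=> k; rewrite /slide tK KS2 volt_subst cut_subst it /=.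
  rewrite (eq_cut (ik k)) (eq_volt (ik k)).
  rewrite addbA addbb [k i == _]eq_sym.
  by do 2 case: (cut _ _) => //=; rewrite ?andbF // ?andbT andbC.
- have [t tE tK] := T2 P1; exists t.
    rewrite perm_sym (perm_trans cs') // perm_catC /= perm_cons perm_sym.
    by rewrite (perm_trans tE) // perm_cat2l.
  by move=> k; rewrite tK /slide (cP1 k).1 (cP1 k).2.
- have [t eT tK] := R2 e eA; exists (subst j (Ser (Leaf j) P1) t).
    rewrite perm_sym (perm_trans cs') // perm_catC perm_sym.
    apply: (@edges_subst _ j _ _ [:: e] A (i :: B) uA eT).
      by rewrite inE; apply: contraTneq eA => <-; case/andP: uA.
    by rewrite /= perm_cons.
  have ej : e != j by apply: contraTneq eA => ->; case/andP: uA.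
  have jt : j \in edges t.
    have : j \in e :: edges t by rewrite (perm_mem eT) mem_head.
    by rewrite inE eq_sym (negPf ej).
  move=> k; rewrite /slide tK volt_subst cut_subst jt /= (cP1 k).1 (cP1 k).2.
  rewrite {3}/upd (negPf ej).
  by do 2 case: (cut _ _); case: (_ == _).
Qed.

End CycleNetwork.

(** * Drawing networks in a lens *)

Section Drawing.
Variables (R : realType) (E : eqType).
Implicit Types (p q : R * R) (e : E) (s r : R) (A : pred E).
Local Open Scope ring_scope.

(** Networks are drawn between the two corners [lpole] and [rpole] of the lens
    [|y| <= x (1 - x)].  At the corners the lens has no vertical extent, so the
    vertical shears used for parallel composition fix the terminals. *)
Definition lens p : bool :=
  [&& 0 <= p.1 <= 1, - (p.1 * (1 - p.1)) <= p.2 & p.2 <= p.1 * (1 - p.1)].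

Definition lpole : R * R := (0, 0).
Definition rpole : R * R := (1, 0).

Lemma lens_lpole : lens lpole.
Proof. by rewrite /lens /=; apply/and3P; split; lra. Qed.

Lemma lens_rpole : lens rpole.
Proof. by rewrite /lens /=; apply/and3P; split; lra. Qed.

Lemma lens_left p : lens p -> p.1 = 0 -> p = lpole.
Proof.
case: p => x y /and3P[/= _ y1 y2] x0; rewrite x0 in y1 y2 *.
by congr pair; lra.
Qed.

Lemma lens_right p : lens p -> p.1 = 1 -> p = rpole.
Proof.
case: p => x y /and3P[/= _ y1 y2] x0; rewrite x0 in y1 y2 *.
by congr pair; lra.
Qed.

Definition cont (c : R -> R * R) : Prop :=
  continuous (fun s => (c s).1) /\ continuous (fun s => (c s).2).

Definition lens_map (m : R * R -> R * R) : Prop :=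
  [/\ forall c, cont c -> cont (m \o c),
      forall p, lens p -> lens (m p),
      forall p, lens p -> 0 < p.1 < 1 -> 0 < (m p).1 < 1 &
      {in lens &, injective m}].

(** The lens is mapped into two smaller lenses with a common corner, or into two
    strips of the lens, above and below the horizontal axis. *)
Definition serl p : R * R := (p.1 / 2, p.2 / 4).
Definition serr p : R * R := ((1 + p.1) / 2, p.2 / 4).
Definition parl p : R * R := (p.1, p.2 / 4 + p.1 * (1 - p.1) / 2).
Definition parr p : R * R := (p.1, p.2 / 4 - p.1 * (1 - p.1) / 2).

Lemma cont_affine (a b : R) (f : R -> R) : continuous f ->
  continuous (fun s => a * f s + b).
Proof.
move=> cf s; apply: cvgD; last exact: cvg_cst.
by apply: cvgM; [exact: cvg_cst | exact: cf].
Qed.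

Lemma cont_add (f g : R -> R) : continuous f -> continuous g ->
  continuous (fun s => f s + g s).
Proof. by move=> cf cg s; apply: cvgD; [exact: cf | exact: cg]. Qed.

Lemma cont_bump (f : R -> R) : continuous f ->
  continuous (fun s => f s * (1 - f s)).
Proof.
move=> cf s; apply: cvgM; first exact: cf.
by apply: cvgB; [exact: cvg_cst | exact: cf].
Qed.

Lemma cont_eq (f g : R -> R) : f =1 g -> continuous f -> continuous g.
Proof. by move=> /funext ->. Qed.

Lemma lens_map_serl : lens_map serl.
Proof.
split.
- move=> c [c1 c2]; split.
    by apply: (cont_eq _ (@cont_affine (1/2) 0 _ c1)) => s /=; lra.
  by apply: (cont_eq _ (@cont_affine (1/4) 0 _ c2)) => s /=; lra.
- move=> [x y] /and3P[/= x01 y1 y2]; apply/and3P; split=> /=; try lra; nra.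
- by move=> [x y] _ /=; lra.
- by move=> [x y] [x' y'] _ _ [] /= ? ?; congr pair; lra.
Qed.

Lemma lens_map_serr : lens_map serr.
Proof.
split.
- move=> c [c1 c2]; split.
    by apply: (cont_eq _ (@cont_affine (1/2) (1/2) _ c1)) => s /=; lra.
  by apply: (cont_eq _ (@cont_affine (1/4) 0 _ c2)) => s /=; lra.
- move=> [x y] /and3P[/= x01 y1 y2]; apply/and3P; split=> /=; try lra; nra.
- by move=> [x y] _ /=; lra.
- by move=> [x y] [x' y'] _ _ [] /= ? ?; congr pair; lra.
Qed.

Lemma lens_map_parl : lens_map parl.
Proof.
split.
- move=> c [c1 c2]; split; first exact: c1.
  have := cont_add (@cont_affine (1/4) 0 _ c2)
                   (@cont_affine (1/2) 0 _ (cont_bump c1)).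
  by apply: cont_eq => s /=; lra.
- by move=> [x y] /and3P[/= x01 y1 y2]; apply/and3P; split=> /=; lra.
- by [].
- by move=> [x y] [x' y'] _ _ [] /= -> ?; congr pair; lra.
Qed.

Lemma lens_map_parr : lens_map parr.
Proof.
split.
- move=> c [c1 c2]; split; first exact: c1.
  have := cont_add (@cont_affine (1/4) 0 _ c2)
                   (@cont_affine (-1/2) 0 _ (cont_bump c1)).
  by apply: cont_eq => s /=; lra.
- by move=> [x y] /and3P[/= x01 y1 y2]; apply/and3P; split=> /=; lra.
- by [].
- by move=> [x y] [x' y'] _ _ [] /= -> ?; congr pair; lra.
Qed.

Lemma ser_overlap p q : lens p -> lens q -> serl p = serr q ->
  p = rpole /\ q = lpole.
Proof.
move=> lp lq [] pq _; have /and3P[p01 _ _] := lp; have /and3P[q01 _ _] := lq.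
by split; [apply: lens_right => //; lra | apply: lens_left => //; lra].
Qed.

Lemma par_overlap p q : lens p -> lens q -> parl p = parr q ->
  p = q /\ (p = lpole \/ p = rpole).
Proof.
move=> lp lq [] pq; rewrite -pq => e.
have /and3P[p01 p1 p2] := lp; have /and3P[_ q1 q2] := lq; rewrite -pq in q1 q2.
have : p.1 * (1 - p.1) = 0 by lra.
move/eqP; rewrite mulf_eq0 => /orP[/eqP x0|/eqP x1].
  have -> := lens_left lp x0; have -> := lens_left lq (etrans (esym pq) x0).
  by split=> //; left.
have x1' : p.1 = 1 by lra.
have -> := lens_right lp x1'; have -> := lens_right lq (etrans (esym pq) x1').
by split=> //; right.
Qed.

(** Allowing [r] to be an endpoint in the last clause says that the interior of
    an edge avoids all vertices, since the vertices will be the ends of the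
    edges. *)
Definition drawn A (D : E -> R -> R * R) : Prop :=
  [/\ forall e, A e -> cont (D e),
      forall e s, A e -> 0 <= s <= 1 -> lens (D e s),
      forall e s, A e -> 0 < s < 1 -> 0 < (D e s).1 < 1 &
      forall e f s r, A e -> A f -> 0 < s < 1 -> 0 <= r <= 1 ->
        D e s = D f r -> e = f /\ s = r].

(** The images of the two drawings may only meet at the images of corners, which
    interior points of edges avoid. *)
Lemma drawn_glue A A1 A2 D1 D2 m1 m2 :
  drawn A1 D1 -> drawn A2 D2 -> lens_map m1 -> lens_map m2 ->
  (forall p q, lens p -> lens q -> m1 p = m2 q ->
     ~~ (0 < p.1 < 1) /\ ~~ (0 < q.1 < 1)) ->
  (forall e, A e -> ~~ A1 e -> A2 e) ->
  drawn A (fun e => if A1 e then m1 \o D1 e else m2 \o D2 e).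
Proof.
move=> [c1 l1 i1 j1] [c2 l2 i2 j2] [mc1 ml1 mi1 mj1] [mc2 ml2 mi2 mj2] mm HA.
have w s : 0 < s < 1 -> 0 <= s <= 1 by lra.
split.
- by move=> e Ae; case: ifPn => A1e; [apply/mc1/c1 | apply/mc2/c2/HA].
- move=> e s Ae s01; case: ifPn => A1e /=; [exact/ml1/l1|].
  by apply/ml2/l2 => //; exact: HA.
- move=> e s Ae s01; case: ifPn => A1e /=.
    by apply: mi1; [apply: l1 => //; exact: w | apply: i1].
  by apply: mi2; [apply: l2; [exact: HA | exact: w] | apply: i2 => //; exact: HA].
- move=> e f s r Ae Af s01 r01; case: ifPn => A1e; case: ifPn => A1f /= mE.
  + by apply: j1 => //; apply: mj1 mE; apply: l1 => //; exact: w.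
  + case: (mm _ _ _ _ mE); [by apply: l1 => //; exact: w|by apply: l2 => //; exact: HA|].
    by rewrite i1.
  + case: (mm _ _ _ _ (esym mE)); [exact: l1|by apply: l2; [exact: HA|exact: w]|].
    by rewrite i2 ?andbF //; exact: HA.
  + have A2e := HA e Ae A1e; have A2f := HA f Af A1f.
    by apply: j2 => //; apply: mj2 mE; apply: l2 => //; exact: w.
Qed.

Lemma drawn_ser A A1 A2 D1 D2 : drawn A1 D1 -> drawn A2 D2 ->
  (forall e, A e -> ~~ A1 e -> A2 e) ->
  drawn A (fun e => if A1 e then serl \o D1 e else serr \o D2 e).
Proof.
move=> d1 d2; apply: drawn_glue => //.
- exact: lens_map_serl.
- exact: lens_map_serr.
- by move=> p q lp lq /(ser_overlap lp lq)[-> ->] /=; split; lra.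
Qed.

Lemma drawn_par A A1 A2 D1 D2 : drawn A1 D1 -> drawn A2 D2 ->
  (forall e, A e -> ~~ A1 e -> A2 e) ->
  drawn A (fun e => if A1 e then parl \o D1 e else parr \o D2 e).
Proof.
move=> d1 d2; apply: drawn_glue => //.
- exact: lens_map_parl.
- exact: lens_map_parr.
- by move=> p q lp lq /(par_overlap lp lq)[-> [->|->]] /=; split; lra.
Qed.

Fixpoint curve (t : spnet E) : E -> R -> R * R :=
  match t with
  | Leaf _ => fun _ s => (s, 0)
  | Ser t1 t2 => fun e =>
      if e \in edges t1 then serl \o curve t1 e else serr \o curve t2 e
  | Par t1 t2 => fun e =>
      if e \in edges t1 then parl \o curve t1 e else parr \o curve t2 e
  end.

Lemma drawn_curve t : drawn (mem (edges t)) (curve t).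
Proof.
elim: t => [a|t1 IH1 t2 IH2|t1 IH1 t2 IH2].
- split=> [e _|e s _ s01|e s _ //|e f s r].
  + by split; [move=> s; apply: cvg_id | move=> s; apply: cvg_cst].
  + by apply/and3P; split=> //=; nra.
  + by rewrite !inE => /eqP-> /eqP-> _ _ /= [->].
- apply: (drawn_ser IH1 IH2) => e; rewrite /= mem_cat => /orP[->//|//].
- apply: (drawn_par IH1 IH2) => e; rewrite /= mem_cat => /orP[->//|//].
Qed.

(** The slope [s - 1/2] determines the parameter, and then the abscissa
    determines the size [h]: teardrops of different sizes only meet at the
    corner.  They are contained in the lens as the slope is at most [1/2]. *)
Definition teardrop (h : R) s : R * R :=
  (h * (s * (1 - s)), h * (s * (1 - s)) * (s - 1 / 2)).

(** The networks [ts] in series, followed by a teardrop at the last corner for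
    each edge that is in none of them. *)
Fixpoint chain (h : E -> R) (ts : seq (spnet E)) : E -> R -> R * R :=
  if ts is t :: ts' then fun e =>
    if e \in edges t then serl \o curve t e else serr \o chain h ts' e
  else fun e => teardrop (h e).

Lemma drawn_chain h ts : injective h -> (forall e, 0 < h e <= 1) ->
  drawn predT (chain h ts).
Proof.
move=> hI h01; elim: ts => [|t ts IH] /=; last first.
  exact: (drawn_ser (drawn_curve t) IH).
have x01 e s : 0 <= s <= 1 -> 0 <= h e * (s * (1 - s)) <= 1 / 4.
  move=> s01; have h1 := h01 e.
  have u : 0 <= s * (1 - s) <= 1 / 4.
    by have sq := sqr_ge0 (s - 1 / 2); apply/andP; split; nra.
  have hu : 0 <= h e * (s * (1 - s)) by apply: mulr_ge0; lra.
  have : 0 <= (1 - h e) * (s * (1 - s)) by apply: mulr_ge0; lra.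
  by lra.
have x0 e s : 0 < s < 1 -> 0 < h e * (s * (1 - s)).
  move=> s01; apply: mulr_gt0; first by have := h01 e; lra.
  by apply: mulr_gt0; lra.
split=> [e _|e s _ s01|e s _ s01|e f s r _ _ s01 r01].
- have c1 : continuous (fun s => h e * (s * (1 - s))).
    move=> s; apply: cvgM; first exact: cvg_cst.
    by apply: (@cont_bump id) => x; apply: cvg_id.
  split=> [|s]; first exact: c1.
  apply: cvgM; first exact: c1.
  by apply: cvgB; [exact: cvg_id | exact: cvg_cst].
- rewrite /lens /teardrop /=; have := x01 e s s01.
  set x := h e * _ => x4; apply/and3P; split; nra.
- by rewrite /teardrop /=; have := x0 e s s01; have := x01 e s; lra.
- rewrite /teardrop => -[] xE; rewrite -xE => yE.
  have sE : s = r.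
    apply: (addIr (- (1 / 2))); apply: mulfI yE.
    by rewrite gt_eqF // x0.
  split=> //; apply: hI; move: xE; rewrite -sE; apply: mulIf.
  by rewrite gt_eqF //; apply: mulr_gt0; lra.
Qed.

Implicit Types (pot : R * R -> bool) (k : E -> bool) (t : spnet E).

Definition coboundary (D : E -> R -> R * R) pot e : bool :=
  pot (D e 0) (+) pot (D e 1).

(** As the maps are injective, potentials on the two pieces extend to the union
    of the images as soon as they agree on the overlap. *)
Lemma glue_potentials m1 m2 pot1 pot2 :
  {in lens &, injective m1} -> {in lens &, injective m2} ->
  (forall p q, lens p -> lens q -> m1 p = m2 q -> pot1 p = pot2 q) ->
  exists pot, (forall p, lens p -> pot (m1 p) = pot1 p) /\
              (forall p, lens p -> pot (m2 p) = pot2 p).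
Proof.
move=> i1 i2 ov.
pose P z q := lens q /\ ((m1 q = z /\ pot1 q) \/ (m2 q = z /\ pot2 q)).
exists (fun z => `[< exists q, P z q >]); split=> p lp /=.
  apply/asboolP/idP => [[q [lq [[qp]|[qp]]]]|pp].
  - by rewrite (i1 _ _ lq lp qp).
  - by rewrite (ov p q).
  - by exists p; split=> //; left.
apply/asboolP/idP => [[q [lq [[qp]|[qp]]]]|pp].
- by rewrite -(ov q p).
- by rewrite (i2 _ _ lq lp qp).
- by exists p; split=> //; right.
Qed.

Lemma serl_lpole : serl lpole = lpole. Proof. by congr pair => /=; lra. Qed.
Lemma serr_rpole : serr rpole = rpole. Proof. by congr pair => /=; lra. Qed.
Lemma serlr : serl rpole = serr lpole. Proof. by congr pair => /=; lra. Qed.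
Lemma parl_lpole : parl lpole = lpole. Proof. by congr pair => /=; lra. Qed.
Lemma parl_rpole : parl rpole = rpole. Proof. by congr pair => /=; lra. Qed.
Lemma parr_lpole : parr lpole = lpole. Proof. by congr pair => /=; lra. Qed.
Lemma parr_rpole : parr rpole = rpole. Proof. by congr pair => /=; lra. Qed.

Lemma ends_lens A D e : drawn A D -> A e -> lens (D e 0) /\ lens (D e 1).
Proof. by move=> [_ l _ _] Ae; split; apply: l => //; lra. Qed.

Lemma uniq_catP (s t : seq E) : uniq (s ++ t) ->
  [/\ uniq s, uniq t & {in t, forall x, (x \in s) = false}].
Proof.
by rewrite cat_uniq => /and3P[us /hasPn st ut]; split=> // x /st /negbTE.
Qed.

(** With the next lemma: [cut] and [volt] describe the potentials on the drawing
    of a network. *)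
Lemma coboundary_cut t pot k : uniq (edges t) ->
  {in edges t, k =1 coboundary (curve t) pot} ->
  cut t k /\ volt t k = pot lpole (+) pot rpole.
Proof.
elim: t pot => [a|t1 IH1 t2 IH2|t1 IH1 t2 IH2] pot /= + kE.
- by split=> //; rewrite kE ?mem_head.
- move=> /uniq_catP[/IH1{}IH1 /IH2{}IH2 t21].
  have [|c1 v1] := IH1 (pot \o serl).
    by move=> e e1; rewrite kE ?mem_cat ?e1 // /coboundary e1.
  have [|c2 v2] := IH2 (pot \o serr).
    by move=> e e2; rewrite kE ?mem_cat ?e2 ?orbT // /coboundary t21.
  rewrite c1 c2 v1 v2 /= serl_lpole serr_rpole serlr; split=> //.
  by case: (pot lpole); case: (pot rpole); case: (pot _).
- move=> /uniq_catP[/IH1{}IH1 /IH2{}IH2 t21].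
  have [|c1 v1] := IH1 (pot \o parl).
    by move=> e e1; rewrite kE ?mem_cat ?e1 // /coboundary e1.
  have [|c2 v2] := IH2 (pot \o parr).
    by move=> e e2; rewrite kE ?mem_cat ?e2 ?orbT // /coboundary t21.
  by rewrite c1 c2 v1 v2 /= parl_lpole parl_rpole parr_lpole parr_rpole eqxx.
Qed.

(** The value [b] at the left corner is free, so that potentials on consecutive
    pieces can be made to agree at their common corner. *)
Lemma cut_coboundary t k (b : bool) : uniq (edges t) -> cut t k ->
  exists pot, [/\ pot lpole = b, pot rpole = b (+) volt t k &
    {in edges t, k =1 coboundary (curve t) pot}].
Proof.
elim: t b => [a|t1 IH1 t2 IH2|t1 IH1 t2 IH2] b /=.
- move=> _ _; exists (fun p => b (+) ((p == rpole) && k a)).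
  rewrite eqxx; split=> //.
    by rewrite xpair_eqE /= eq_sym oner_eq0 addbF.
  move=> e; rewrite inE => /eqP->; rewrite /coboundary /= !xpair_eqE !eqxx.
  by rewrite eq_sym oner_eq0 /= addbF addbA addbb.
- move=> /uniq_catP[u1 u2 t21] /andP[k1 k2].
  have [p1 [p10 p11 p1E]] := IH1 b u1 k1.
  have [p2 [p20 p21 p2E]] := IH2 (b (+) volt t1 k) u2 k2.
  have [||p q lp lq /(ser_overlap lp lq)[-> ->]|pot [e1 e2]] :=
    @glue_potentials serl serr p1 p2.
  + by case: lens_map_serl.
  + by case: lens_map_serr.
  + by rewrite p11.
  exists pot; split.
  + by rewrite -serl_lpole e1 ?lens_lpole.
  + by rewrite -serr_rpole e2 ?lens_rpole // p21 addbA.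
  move=> e; rewrite mem_cat => /orP[e_1|e_2].
    have [l0 l1] := ends_lens (drawn_curve t1) e_1.
    by rewrite p1E // /coboundary /= e_1 /= !e1.
  have [l0 l1] := ends_lens (drawn_curve t2) e_2.
  by rewrite p2E // /coboundary /= t21 //= !e2.
- move=> /uniq_catP[u1 u2 t21] /and3P[k1 k2 /eqP v12].
  have [p1 [p10 p11 p1E]] := IH1 b u1 k1.
  have [p2 [p20 p21 p2E]] := IH2 b u2 k2.
  have [||p q lp lq /(par_overlap lp lq)[<- [->|->]]|pot [e1 e2]] :=
    @glue_potentials parl parr p1 p2.
  + by case: lens_map_parl.
  + by case: lens_map_parr.
  + by rewrite p10.
  + by rewrite p11 v12.
  exists pot; split.
  + by rewrite -parl_lpole e1 ?lens_lpole.
  + by rewrite -parl_rpole e1 ?lens_rpole // p11.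
  move=> e; rewrite mem_cat => /orP[e_1|e_2].
    have [l0 l1] := ends_lens (drawn_curve t1) e_1.
    by rewrite p1E // /coboundary /= e_1 /= !e1.
  have [l0 l1] := ends_lens (drawn_curve t2) e_2.
  by rewrite p2E // /coboundary /= t21 //= !e2.
Qed.

Lemma curve_connected t pot : uniq (edges t) ->
  {in edges t, forall e, coboundary (curve t) pot e = false} ->
  pot rpole = pot lpole /\
  {in edges t, forall e, pot (curve t e 0) = pot lpole}.
Proof.
elim: t pot => [a|t1 IH1 t2 IH2|t1 IH1 t2 IH2] pot /= + pE.
- move=> _; have := pE a (mem_head _ _); rewrite /coboundary /=.
  by rewrite -/lpole -/rpole; case: (pot _); case: (pot _).
- move=> /uniq_catP[/IH1{}IH1 /IH2{}IH2 t21].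
  have [|r1 c1] := IH1 (pot \o serl).
    by move=> e e1; rewrite -(pE e) ?mem_cat ?e1 // /coboundary e1.
  have [|r2 c2] := IH2 (pot \o serr).
    by move=> e e2; rewrite -(pE e) ?mem_cat ?e2 ?orbT // /coboundary t21.
  move: r1 r2 c1 c2; rewrite /= serl_lpole serr_rpole serlr => r1 r2 c1 c2.
  split; first by rewrite r2 r1.
  move=> e; rewrite mem_cat => /orP[e1|e2]; first by rewrite e1 /= c1.
  by rewrite t21 //= c2 // r1.
- move=> /uniq_catP[/IH1{}IH1 /IH2{}IH2 t21].
  have [|r1 c1] := IH1 (pot \o parl).
    by move=> e e1; rewrite -(pE e) ?mem_cat ?e1 // /coboundary e1.
  have [|_ c2] := IH2 (pot \o parr).
    by move=> e e2; rewrite -(pE e) ?mem_cat ?e2 ?orbT // /coboundary t21.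
  move: r1 c1 c2; rewrite /= parl_lpole parl_rpole parr_lpole => r1 c1 c2.
  split=> // e; rewrite mem_cat => /orP[e1|e2]; first by rewrite e1 /= c1.
  by rewrite t21 //= c2.
Qed.

Variable h : E -> R.
Hypotheses (h_inj : injective h) (h01 : forall e, 0 < h e <= 1).

Lemma teardrop_ends x : teardrop x 0 = lpole /\ teardrop x 1 = lpole.
Proof. by split; congr pair => /=; lra. Qed.

Lemma eq_all_cut ts k k' : {in flatten (map edges ts), k =1 k'} ->
  all (fun t => cut t k) ts = all (fun t => cut t k') ts.
Proof.
elim: ts => //= t ts IH kk'; rewrite (@eq_cut _ t k k') ?IH // => e et;
  by apply: kk'; rewrite mem_cat et ?orbT.
Qed.

Lemma coboundary_chain ts pot k : uniq (flatten (map edges ts)) ->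
  k =1 coboundary (chain h ts) pot ->
  all (fun t => cut t k) ts /\
  forall e, e \notin flatten (map edges ts) -> k e = false.
Proof.
elim: ts pot k => [|t ts IH] pot k /=.
  move=> _ kE; split=> // e _; rewrite kE /coboundary /=.
  by have [-> ->] := teardrop_ends (h e); rewrite addbb.
move=> /uniq_catP[ut uts tst] kE.
have [|-> _] := @coboundary_cut t (pot \o serl) k ut.
  by move=> e et; rewrite kE /coboundary et.
(* The edges of t are no edges of the tail; there k' is defined so as to be the
   coboundary that the induction hypothesis asks for. *)
pose k' e := if e \in edges t then coboundary (chain h ts) (pot \o serr) e else k e.
have [|ck' k'0] := IH (pot \o serr) k' uts.
  by move=> e; rewrite /k'; case: ifPn => // et; rewrite kE /coboundary (negPf et).
split=> /=.
  by rewrite -(@eq_all_cut ts k') // => e ets; rewrite /k' tst.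
by move=> e; rewrite mem_cat negb_or => /andP[/negPf et /k'0]; rewrite /k' et.
Qed.

Lemma chain_coboundary ts k : uniq (flatten (map edges ts)) ->
  all (fun t => cut t k) ts ->
  (forall e, e \notin flatten (map edges ts) -> k e = false) ->
  exists pot, k =1 coboundary (chain h ts) pot.
Proof.
move=> uts cts k0; suff : forall b, exists2 pot, pot lpole = b &
    forall e, (e \in flatten (map edges ts)) || ~~ k e ->
      k e = coboundary (chain h ts) pot e.
  case/(_ false) => pot _ potE; exists pot => e; apply: potE.
  by case: (boolP (e \in _)) => //= /k0 ->.
elim: ts uts cts {k0} => [|t ts IH] /= + + b.
  move=> _ _; exists (fun=> b) => // e /= /negPf->.
  by rewrite /coboundary addbb.
move=> /uniq_catP[ut uts tst] /andP[kt /IH{}IH].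
have [p1 [p10 p11 p1E]] := cut_coboundary b ut kt.
have [p2 p20 p2E] := IH uts (b (+) volt t k).
have [||p q lp lq /(ser_overlap lp lq)[-> ->]|pot [e1 e2]] :=
  @glue_potentials serl serr p1 p2.
- by case: lens_map_serl.
- by case: lens_map_serr.
- by rewrite p11.
exists pot; first by rewrite -serl_lpole e1 ?lens_lpole.
move=> e eE; rewrite /coboundary; case: ifPn => et /=.
  have [l0 l1] := ends_lens (drawn_curve t) et.
  by rewrite p1E // /coboundary /= !e1.
have [l0 l1] := @ends_lens _ _ e (drawn_chain ts h_inj h01) isT.
rewrite p2E /coboundary /= ?e2 //.
by move: eE; rewrite mem_cat (negPf et).
Qed.

Lemma chain_connected ts pot : uniq (flatten (map edges ts)) ->
  {in flatten (map edges ts), forall e,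
    coboundary (chain h ts) pot e = false} ->
  forall e, pot (chain h ts e 0) = pot lpole.
Proof.
elim: ts pot => [|t ts IH] pot /=.
  by move=> _ _ e; have [-> _] := teardrop_ends (h e).
move=> /uniq_catP[ut uts tst] pE.
have [|r c] := @curve_connected t (pot \o serl) ut.
  by move=> e et; rewrite -(pE e) ?mem_cat ?et // /coboundary et.
move: r c; rewrite /= serl_lpole serlr => r c.
move=> e; case: ifPn => et /=; first by rewrite c.
rewrite -r; apply: (IH (pot \o serr)) => // f fts.
by rewrite -(pE f) ?mem_cat ?fts ?orbT // /coboundary tst.
Qed.

End Drawing.

(** * Graphs from drawings *)

Section DrawnGraph.
Variables (R : realType) (E : finType) (D : E -> R -> R * R).
Local Open Scope ring_scope.

(** The left corner is added so that the graph has a vertex even without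
    edges. *)
Definition endpoints : seq (R * R) :=
  lpole R :: [seq D e 0 | e <- enum E] ++ [seq D e 1 | e <- enum E].

Lemma endpoint0 e : D e 0 \in endpoints.
Proof. by rewrite inE mem_cat (map_f (fun e => D e 0)) ?mem_enum ?orbT. Qed.

Lemma endpoint1 e : D e 1 \in endpoints.
Proof. by rewrite inE mem_cat (map_f (fun e => D e 1)) ?mem_enum ?orbT. Qed.

Lemma endpointP p : p \in endpoints ->
  p = lpole R \/ exists e, p = D e 0 \/ p = D e 1.
Proof.
rewrite inE mem_cat => /predU1P[->|]; first by left.
by case/orP => /mapP[e _ ->]; right; exists e; [left | right].
Qed.

Definition drawn_graph : graph E := @Graph E (seq_sub endpoints)
  (fun e => (SeqSub (endpoint0 e), SeqSub (endpoint1 e))).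

Lemma planar_drawn_graph : drawn predT D -> planar drawn_graph R.
Proof.
move=> [cD _ iD jD].
exists (fun v => val (v : seq_sub endpoints)), D; split.
- exact: val_inj.
- move=> e; split=> //; apply: continuous_subspaceT => s.
  have [c1 c2] := cD e isT.
  have -> : D e = (fun s => ((D e s).1, (D e s).2)).
    by apply/funext => x; case: (D e x).
  exact: (@cvg_pair _ _ _ (nbhs s) _ _ _ _ _ _ _ (c1 s) (c2 s)).
- move=> e t v t01 Dv; have := iD e t isT t01; rewrite Dv.
  case/endpointP: (valP v) => [->|[f fE]]; first by rewrite /= ltxx.
  have ne r : r = 0 \/ r = 1 -> D e t = D f r -> False.
    move=> r01 /(jD e f t r isT isT t01)[|_ tr]; first by case: r01 => ->; lra.
    by move: t01; rewrite tr; case: r01 => ->; rewrite ltxx ?andbF.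
  by case: fE => fE _; [apply: (ne 0) | apply: (ne 1)]; rewrite ?Dv; auto.
- by move=> e f s t s01 t01; apply: jD => //; lra.
Qed.

Lemma connect_coboundary (F : {set E}) e : reflect
  (forall pot, (forall f, f \in F -> coboundary D pot f = false) ->
     coboundary D pot e = false)
  (connect (@adj E drawn_graph F)
     (ends drawn_graph e).1 (ends drawn_graph e).2).
Proof.
apply: (iffP (connect_potential _ _ _)) => H.
  move=> pot potF; have := H (fun v => pot (val (v : seq_sub endpoints))).
  rewrite /coboundary /= => -> //; first by rewrite addbb.
  by move=> f /potF; rewrite /coboundary; case: (pot _); case: (pot _).
move=> p pF; pose pot z := if insub z is Some v then p v else false.
have potE v : pot (val (v : seq_sub endpoints)) = p v by rewrite /pot valK.
have cE f : coboundary D pot f =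
    p (ends drawn_graph f).1 (+) p (ends drawn_graph f).2.
  by rewrite -!potE.
have : coboundary D pot e = false.
  by apply: H => g /pF; rewrite cE => ->; rewrite addbb.
by rewrite cE; case: (p _); case: (p _).
Qed.

Lemma connected_drawn_graph :
  (forall pot, (forall e, coboundary D pot e = false) ->
     forall e, pot (D e 0) = pot (lpole R)) ->
  connected_graph drawn_graph.
Proof.
move=> H; have l0 : lpole R \in endpoints by rewrite mem_head.
apply/andP; split; first by apply/card_gt0P; exists (SeqSub l0).
apply/forallP => u; apply/forallP => v; apply/connect_potential => p pE.
pose pot z := if insub z is Some v then p v else false.
have potE w : pot (val (w : seq_sub endpoints)) = p w by rewrite /pot valK.
have c0 e : coboundary D pot e = false.
  by have := pE e; rewrite inE -!potE => /(_ isT) eE; rewrite /coboundary eE addbb.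
suff pl w : p w = pot (lpole R) by rewrite !pl.
rewrite -potE; case/endpointP: (valP w) => [->//|[e eE]].
have e0 := H pot c0 e; case: eE => -> //.
by move: (c0 e); rewrite /coboundary e0; case: (pot _); case: (pot _).
Qed.

End DrawnGraph.

(** * Assembling the components *)

Section Orbits.
Variables (T : finType) (f : T -> T).
Hypothesis f_inj : injective f.

Lemma fconnect_fixed x y : f x = x -> fconnect f x y -> y = x.
Proof. by move=> fx /iter_findex <-; elim: (findex f x y) => //= n ->. Qed.

Lemma orbit_fixed r x : x \in orbit f r -> f x = x -> orbit f r = [:: r].
Proof.
rewrite -fconnect_orbit => rx fx.
have all_x y : y \in orbit f r -> y = r.
  have xr : r = x by apply: fconnect_fixed fx _; rewrite fconnect_sym.
  by rewrite -fconnect_orbit xr; apply: fconnect_fixed.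
have := orbit_uniq f r; have := in_orbit f r.
case: (orbit f r) all_x => [//|a s] all_x _.
have -> : a = r by apply: all_x; rewrite mem_head.
case: s all_x => [//|b s] all_x.
have -> : b = r by apply: all_x; rewrite !inE eqxx orbT.
by rewrite /= mem_head.
Qed.

End Orbits.

Lemma uniq_flatten_key (T T' : eqType) (F : T -> seq T') (key : T' -> T) s :
  uniq s -> {in s, forall r, uniq (F r)} ->
  {in s, forall r, {in F r, forall x, key x = r}} ->
  uniq (flatten [seq F r | r <- s]).
Proof.
elim: s => //= r s IH /andP[rs us] uF kF; rewrite cat_uniq uF ?mem_head //=.
rewrite IH ?andbT //; last 2 first.
- by move=> q qs; apply: uF; rewrite inE qs orbT.
- by move=> q qs; apply: kF; rewrite inE qs orbT.
apply/hasPn => x /flatten_mapP[q qs xq]; apply: contraNN rs => xr.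
by rewrite -(kF r (mem_head _ _) x xr) (kF q _ x xq) // inE qs orbT.
Qed.

Theorem theorem3p3 (R : realType) (d : Order.disp_t) (E : finOrderType d)
    (pi : decorated_perm E) :
  exists G : graph E,
    [/\ connected_graph G, planar G R
      & forall e : E,
          dperm_value pi e = matroid_dperm_value (cycle_matroid G) e].
Proof.
pose f : E -> E := dperm pi; have f_inj : injective f := perm_inj.
pose is_loop e := if dperm_value pi e is Under _ then true else false.
have valueE e : dperm_value pi e =
    if is_loop e then Under e else if f e == e then Over e else Plain (f e).
  rewrite /is_loop /dperm_value /f; case: insubP => [x fe _|/negPf ->] //.
  by rewrite fe; case: (dcol x).
have loop_fixed e : is_loop e -> f e = e.
  by have := valueE e; rewrite /is_loop /dperm_value; case: insubP => // x /eqP.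
have orbitE e y : (y \in orbit f e) = (froot f y == froot f e).
  by rewrite -fconnect_orbit fconnect_sym // root_connect //; apply: fconnect_sym.
have component r : exists t, perm_eq (edges t) (orbit f r) /\
    realizes (cut t) (orbit f r) f.
  case: (ltnP 1 (size (orbit f r))) => sz.
    have fx : {in orbit f r, forall x, f x != x}.
      by move=> x xr; apply: contraTneq sz => fx; rewrite (orbit_fixed f_inj xr fx).
    have [K Kr KR] := cycle_network sz (orbit_uniq f r) (cycle_orbit f_inj r) fx.
    have [t tE KE] := KR r (in_orbit f r); exists (Par (Leaf r) t); split=> //.
    suff <- : K = cut (Par (Leaf r) t) by [].
    by apply/funext => k; rewrite KE /= eq_sym.
  have fr : f r = r.
    have : f r \in orbit f r by rewrite -fconnect_orbit fconnect1.
    have := in_orbit f r; case: (orbit f r) sz => [//|a [|//]] _.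
    by rewrite !inE => /eqP ra /eqP ->.
  rewrite (orbit_fixed f_inj (in_orbit f r) fr).
  by exists (Leaf r); split=> //; exact: coloop_realizes.
have [tau tauP] := choice component.
(* One representative for each cycle that is not a loop. *)
pose reps := [seq r <- enum E | (froot f r == r) && ~~ is_loop r].
pose ts := [seq tau r | r <- reps].
have mem_tau r e : r \in reps -> e \in edges (tau r) -> froot f e = r.
  rewrite mem_filter => /andP[/andP[/eqP fr _] _].
  by rewrite (perm_mem (tauP r).1) orbitE fr => /eqP.
have root_reps e : ~~ is_loop e -> froot f e \in reps.
  rewrite mem_filter mem_enum andbT root_root ?eqxx /=; last exact: fconnect_sym.
  apply: contraNN => lr; have rE := connect_root (frel f) e.
  rewrite fconnect_sym // in rE.
  by rewrite (fconnect_fixed (loop_fixed _ lr) rE).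
have memS e : (e \in flatten (map edges ts)) = ~~ is_loop e.
  rewrite /ts -map_comp; apply/flatten_mapP/idP => [[r rr /= er]|le].
    apply: contraTN rr => le; rewrite mem_filter.
    rewrite (perm_mem (tauP r).1) in er; move: (er).
    rewrite (orbit_fixed f_inj er (loop_fixed _ le)) inE => /eqP <-.
    by rewrite le andbF.
  exists (froot f e); first exact: root_reps.
  rewrite /= (perm_mem (tauP _).1) orbitE root_root //; exact: fconnect_sym.
have uS : uniq (flatten (map edges ts)).
  rewrite /ts -map_comp; apply: (@uniq_flatten_key _ _ _ (froot f)).
  - by rewrite filter_uniq ?enum_uniq.
  - by move=> r _ /=; rewrite (perm_uniq (tauP r).1) orbit_uniq.
  - by move=> r rr x /=; apply: mem_tau.
(* The sizes of the teardrops. *)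
pose h (e : E) : R := ((rank e).+1%:R^-1)%R.
have h_inj : injective h.
  move=> x y /invr_inj/eqP; rewrite eqr_nat => /eqP[]; exact: rank_inj.
have h01 e : (0 < h e <= 1)%R.
  by rewrite invr_gt0 ltr0n /= invf_le1 ?ltr0n // ler1n.
pose D := chain h ts; exists (drawn_graph D).
have cutD pot r : r \in reps -> cut (tau r) (coboundary D pot).
  have [] := @coboundary_chain R E h ts pot _ uS (fun=> erefl _).
  by rewrite all_map => /allP H _ /H.
have loopD pot e : is_loop e -> coboundary D pot e = false.
  have [_ H] := @coboundary_chain R E h ts pot _ uS (fun=> erefl _).
  by move=> le; apply: H; rewrite memS le.
split.
- by apply: connected_drawn_graph => pot pE; apply: chain_connected.
- by apply: planar_drawn_graph; apply: drawn_chain.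
move=> e; rewrite valueE /matroid_dperm_value mcoloop_connect mloop_ends.
case: (boolP (is_loop e)) => le.
  rewrite (introT (connect_coboundary _ _ _)); last by move=> pot _; apply: loopD.
  rewrite ifT //; apply/eqP/val_inj/eqP => /=.
  have := loopD (fun p => p == D e 0%R) e le; rewrite /coboundary eqxx eq_sym.
  by case: (_ == _).
(* A cut of the component of e, extended by zero, is a cut of the whole graph:
   the closure of a set is computed in the component. *)
have connectE n : connect (@adj E (drawn_graph D) [set y | window e n y])
    (ends (drawn_graph D) e).1 (ends (drawn_graph D) e).2 = window e n (f e).
  have rr := root_reps e le; set r := froot f e in rr.
  have [tauE tauR] := tauP r.
  have er : e \in orbit f r by rewrite orbitE root_root //; apply: fconnect_sym.
  apply/connect_coboundary/idP => [H|/(tauR e er) H pot potF]; last first.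
    apply: H (cutD pot r rr) _ => y _ wy; apply: potF; by rewrite inE.
  apply/(tauR e er) => k kr kF.
  pose k' y := (y \in orbit f r) && k y.
  have [||pot potE] := @chain_coboundary R E h h_inj h01 ts k' uS.
  - rewrite all_map; apply/allP => q qr /=; case: (eqVneq q r) => [->|qr'].
      rewrite (@eq_cut _ _ k' k) // => y; rewrite (perm_mem tauE) /k' => ->.
      by [].
    rewrite (@eq_cut _ _ k' (fun=> false)) ?cut0 // => y yq.
    rewrite /k' orbitE (mem_tau q) //; case: eqP => // qE.
    move: rr; rewrite mem_filter => /andP[/andP[/eqP rE _] _].
    by rewrite qE rE eqxx in qr'.
  - move=> y; rewrite memS negbK /k' orbitE => ly; case: eqP => //= yE.
    have ye : fconnect f y e.
      rewrite -(root_connect (fconnect_sym f_inj)) yE root_root //.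
      exact: fconnect_sym.
    by move: le; rewrite (fconnect_fixed (loop_fixed _ ly) ye) ly.
  have : k' e = false; last by rewrite /k' er.
  rewrite potE; apply: H => y; rewrite inE -potE /k' => wy.
  by case: (boolP (y \in _)) => //= yr; apply: kF.
have allE : ~: [set e] = [set y | window e #|E| y].
  by apply/setP => y; rewrite !inE windowT.
rewrite {1}allE connectE windowT; case: (eqVneq (f e) e) => //= fe.
rewrite ifF; last first.
  apply/negP => /eqP eE; have := connectE 0.
  by rewrite window0 /= eE connect0.
rewrite [X in cyc_min e X](_ : _ =
  [set x in ~: [set e] | window e (cdist e x) (f e)]).
  by rewrite cyc_min_window.
apply/setP => x; rewrite [LHS]in_set [RHS]in_set !in_setC !in_set1.
apply: andb_id2l => xe; rewrite mclosure_connect -connectE.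
congr (connect (adj _) _ _).
by apply/setP => y; rewrite inE cyc_interval_window.
Qed.
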